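(* Let $K$ be a field of characteristic $p>0$ containing a primitive $m$th root of unity, with $p\nmid m$ and $p\ne2$. Let $G=G(m,m,2)$ with $m\ge3$ (so that the 2-dimensional representation $\rho_1$ is defined), take $\hbar=0$ and generic parameters, let $A=K[x,y]$, and let $\tau=\rho_1$. Then the maximal proper graded submodule $J$ of the Verma module $M(\tau)=A\otimes\rho_1$ of the rational Cherednik algebra $\mathbf{H}(G)$ is generated by $x\otimes e_1$, $y\otimes e_2$, $x^3\otimes e_2$, $y^3\otimes e_1$, and the Hilbert series of $(A\otimes\rho_1)/J$ is $2+2t+2t^2$.
   Context: $G(m,m,2)$ is the group of $2\times2$ monomial matrices over $K$ whose nonzero entries are $m$th roots of unity with product $1$; it acts on $\mathfrak{h}=K^2$ and on $\mathfrak{h}^*$ with coordinate basis $x=x_1$, $y=x_2$. Its reflections (finite-order elements $s$ with $\operatorname{rank}(1-s)=1$) are, for $0\le\ell<m$, $x\mapsto\xi^\ell y$, $y\mapsto\xi^{-\ell}x$, with $\xi$ a primitive $m$th root of unity. For $1\le i<m/2$, $\rho_i$ is the $2$-dimensional representation with basis $e_1,e_2$ in which roots of unity act by their $i$th power: the element $x\mapsto\xi^\ell y$, $y\mapsto\xi^{-\ell}x$ acts by $e_1\mapsto\xi^{i\ell}e_2$, $e_2\mapsto\xi^{-i\ell}e_1$. For a reflection $s$ choose $\alpha_s\in\mathfrak{h}^*$ spanning the image of $1-s$ and $\alpha_s^\vee\in\mathfrak{h}$ with $(1-s)f=(\alpha_s^\vee,f)\alpha_s$ for $f\in\mathfrak{h}^*$;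 let $c_s\in K$ depend only on the conjugacy class of $s$ (for $m$ even there are two classes of reflections, according to the parity of $\ell$, with parameters $d$ for $\ell$ even and $c$ for $\ell$ odd; for $m$ odd there is one class). Generic means these parameters are algebraically independent over the prime field. $\mathbf{H}(G)$ ($\hbar=0$) is the quotient of $K[G]\ltimes T(\mathfrak{h}\oplus\mathfrak{h}^* )$ by $[f,f']=0$, $[v,v']=0$, $[v,f]=-\sum_sc_s(v,\alpha_s)(f,\alpha_s^\vee)s$ for $f,f'\in\mathfrak{h}^*$, $v,v'\in\mathfrak{h}$, graded with $\mathfrak{h}^*$ in degree $1$, $\mathfrak{h}$ in degree $-1$, $G$ in degree $0$. The Verma module of $\tau$ is $M(\tau)=A\otimes_K\tau$ with $A=\mathrm{Sym}(\mathfrak{h}^* )$ acting by multiplication, $G$ diagonally, and $v\in\mathfrak{h}$ by the Dunkl operator $D_v(f\otimes w)=-\sum_sc_s\frac{(v,\alpha_s)}{\alpha_s}(1-s)f\otimes sw$. For irreducible $\tau$ it has a unique maximal proper graded submodule $J$; $\tau$ is placed in degree $0$.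
   Formalization: The case m = 4 is excluded: there the claim is false, since for v the second basis vector D_v(x⊗e_1) = 2(d−c)(1⊗e_2) is nonzero for generic parameters and p ≠ 2, so x⊗e_1 is not in J; the result is stated for m = 3 and m ≥ 5. *)

(* Defs.v *)
From HB Require Import structures.
From mathcomp Require Import all_boot all_order all_fingroup all_algebra.
From mathcomp Require Import mpoly generic_quotient boolp classical_sets.

Set Implicit Arguments.
Unset Strict Implicit.
Unset Printing Implicit Defensive.

Import GRing.Theory.
Local Open Scope ring_scope.
Local Open Scope quotient_scope.

Section Group.
Variables (K : fieldType) (m : nat).

Definition monomial_mx n (g : 'M[K]_n) : bool :=
  [exists s : 'S_n, [forall i, [forall j, (g i j != 0) == (j == s i)]]].

Definition in_Gmm2 (g : 'M[K]_2) : bool :=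
  [&& monomial_mx g,
      [forall i, [forall j, (g i j != 0) ==> (g i j ^+ m == 1)]]
    & \prod_i \prod_(j | g i j != 0) g i j == 1].

Definition Gmm2 : Type := {g : 'M[K]_2 | in_Gmm2 g}.

Lemma monomial_mxP n (g : 'M[K]_n) :
  reflect (exists2 s : 'S_n, (forall i, g i (s i) != 0)
             & (forall i j, j != s i -> g i j = 0)) (monomial_mx g).
Proof.
apply: (iffP existsP) => [[s /forallP hs]|[s h1 h2]]; exists s.
- by move=> i; have /forallP/(_ (s i))/eqP -> := hs i; rewrite eqxx.
- move=> i j nj; have /forallP/(_ j) := hs i.
  by rewrite (negPf nj) => /eqP; case: eqVneq.
- apply/forallP => i; apply/forallP => j; apply/eqP.
  by case: (eqVneq j (s i)) => [->|nj]; [exact: h1 | rewrite h2 // eqxx].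
Qed.

Lemma prod_monomial n (g : 'M[K]_n) (s : 'S_n) :
  (forall i, g i (s i) != 0) -> (forall i j, j != s i -> g i j = 0) ->
  \prod_i \prod_(j | g i j != 0) g i j = \prod_i g i (s i).
Proof.
move=> h1 h2; apply: eq_bigr => i _; rewrite (bigD1 (s i)) //= big1 ?mulr1 //.
by move=> j /andP[nz ne]; rewrite h2 ?eqxx // in nz.
Qed.

Lemma in_Gmm2P (g : 'M[K]_2) :
  reflect (exists s : 'S_2, [/\ forall i, g i (s i) != 0,
             forall i j, j != s i -> g i j = 0,
             forall i, g i (s i) ^+ m = 1 & \prod_i g i (s i) = 1])
          (in_Gmm2 g).
Proof.
apply: (iffP and3P) => [[/monomial_mxP[s h1 h2] /forallP h3 h4]|[s [h1 h2 h3 h4]]].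
  exists s; split=> //; last by rewrite -(prod_monomial h1 h2); apply/eqP.
  by move=> i; have /forallP/(_ (s i))/implyP/(_ (h1 i))/eqP := h3 i.
split; first by apply/monomial_mxP; exists s.
  apply/forallP => i; apply/forallP => j; apply/implyP.
  by case: (eqVneq j (s i)) => [-> _|ne]; rewrite ?h3 ?eqxx // h2 ?eqxx.
by rewrite (prod_monomial h1 h2) h4.
Qed.

Lemma Gmm2_1_subproof : in_Gmm2 (1%:M : 'M[K]_2).
Proof.
apply/in_Gmm2P; exists 1%g; split.
- by move=> i; rewrite perm1 mxE eqxx oner_eq0.
- by move=> i j; rewrite perm1 mxE eq_sym => /negPf->.
- by move=> i; rewrite perm1 mxE eqxx expr1n.
- by rewrite big1 // => i _; rewrite perm1 mxE eqxx.
Qed.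

Lemma Gmm2_mul_subproof (g h : Gmm2) : in_Gmm2 (sval g *m sval h).
Proof.
case: g h => g /= /in_Gmm2P[s [g1 g2 g3 g4]] [h /= /in_Gmm2P[t [h1 h2 h3 h4]]].
have E i j : (g *m h) i j = g i (s i) * h (s i) j.
  rewrite mxE (bigD1 (s i)) //= big1 ?addr0 // => k nk.
  by rewrite g2 // mul0r.
apply/in_Gmm2P; exists (s * t)%g; split.
- by move=> i; rewrite E permM mulf_neq0.
- by move=> i j nj; rewrite E h2 ?mulr0 -?permM.
- by move=> i; rewrite E permM exprMn g3 h3 mulr1.
- rewrite (eq_bigr (fun i => g i (s i) * h (s i) (t (s i)))); last first.
    by move=> i _; rewrite E permM.
  rewrite big_split /= g4 mul1r -[RHS]h4.
  by rewrite [RHS](reindex_inj (@perm_inj _ s)).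
Qed.

Definition Gone : Gmm2 := exist _ 1%:M Gmm2_1_subproof.
Definition Gmul (g h : Gmm2) : Gmm2 :=
  exist _ (sval g *m sval h) (Gmm2_mul_subproof g h).

Lemma Gmm2_unit (g : Gmm2) : sval g \in unitmx.
Proof.
case: g => g /= /in_Gmm2P[s [g1 g2 g3 g4]].
pose h := \matrix_(i, j) (if i == s j then (g j i)^-1 else 0).
suff E : g *m h = 1%:M by case/mulmx1_unit: E.
apply/matrixP=> i j; rewrite !mxE (bigD1 (s i)) //= big1 ?addr0; last first.
  by move=> k nk; rewrite g2 // mul0r.
rewrite mxE (inj_eq perm_inj); case: eqVneq => [->|]; last by rewrite mulr0.
by rewrite mulfV.
Qed.

(* Elements of finite order are not singled out: G(m,m,2) is finite. *)
Definition is_reflection (s : Gmm2) : Prop := \rank (1%:M - sval s) = 1%N.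

Definition Gconj (s t : Gmm2) : Prop :=
  exists g : Gmm2, Gmul g s = Gmul t g.

Definition class_fun (c : Gmm2 -> K) : Prop :=
  forall s t, is_reflection s -> Gconj s t -> c s = c t.

End Group.

Section Generic.
Variable K : fieldType.

(* In positive characteristic the prime field is {k%:R | k : nat}. *)
Definition alg_indep_prime_field n (v : 'I_n -> K) : Prop :=
  forall P : {mpoly K[n]},
    (forall mon, exists k : nat, P@_mon = k%:R) -> P.@[v] = 0 -> P = 0.

(* The parameters of a class function c are its values on the distinct
   conjugacy classes of reflections. *)
Definition generic_params m (c : Gmm2 K m -> K) : Prop :=
  forall n (s : 'I_n -> Gmm2 K m),
    (forall i, is_reflection (s i)) ->
    (forall i j, Gconj (s i) (s j) -> i = j) ->
    alg_indep_prime_field (fun i => c (s i)).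

End Generic.

(* h = K^2 is 'cV_2 and h^* is 'rV_2, in the coordinate basis x, y. *)
Section Pairing.
Variable K : fieldType.

Definition pairing (f : 'rV[K]_2) (v : 'cV[K]_2) : K := (f *m v) 0 0.

Lemma pairingDl f f' v : pairing (f + f') v = pairing f v + pairing f' v.
Proof. by rewrite /pairing mulmxDl mxE. Qed.
Lemma pairingZl a f v : pairing (a *: f) v = a * pairing f v.
Proof. by rewrite /pairing -scalemxAl mxE. Qed.
Lemma pairingDr f v v' : pairing f (v + v') = pairing f v + pairing f v'.
Proof. by rewrite /pairing mulmxDr mxE. Qed.
Lemma pairingZr a f v : pairing f (a *: v) = a * pairing f v.
Proof. by rewrite /pairing -scalemxAr mxE. Qed.

End Pairing.

Section Reflections.
Variables (K : fieldType) (m : nat) (xi : K).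
Hypothesis xi_prim : m.-primitive_root xi.

(* With G acting on h^* by f |-> f *m invmx g, this involution is
   x |-> xi^l y, y |-> xi^-l x. *)
Definition refl_mx (l : 'I_m) : 'M[K]_2 :=
  \matrix_(i, j) (if i == j then 0 else if i == 0 then xi ^+ l else xi ^- l).

Lemma xi_unit : xi != 0.
Proof.
apply/eqP => x0; have := prim_expr_order xi_prim.
rewrite x0 expr0n; have := prim_order_gt0 xi_prim; case: (m) => // k _ /= /esym/eqP.
by rewrite oner_eq0.
Qed.

Lemma xiX_unit l : xi ^+ l != 0.
Proof. by rewrite expf_neq0 // xi_unit. Qed.

Lemma refl_mx_inG l : in_Gmm2 m (refl_mx l).
Proof.
have E : tperm (0 : 'I_2) 1 =1 (fun i => if i == 0 then 1 else 0).
  by move=> i; rewrite permE /=; case: i => [[|[|]]].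
have xim k : (xi ^+ k) ^+ m = 1 by rewrite exprAC (prim_expr_order xi_prim) expr1n.
apply/in_Gmm2P; exists (tperm 0 1); split.
- move=> i; rewrite E mxE.
  by case: i => [[|[|]]] //= h; rewrite ?invr_eq0 xiX_unit.
- move=> i j; rewrite E mxE.
  by case: i j => [[|[|]]] //= h [[|[|]]].
- by move=> i; rewrite E mxE; case: i => [[|[|]]] //= h; rewrite ?exprVn xim ?invr1.
- by rewrite big_ord_recl big_ord1 !E !mxE /= mulfV ?xiX_unit.
Qed.

Definition reflG (l : 'I_m) : Gmm2 K m := exist _ (refl_mx l) (refl_mx_inG l).

Definition root_form (l : 'I_m) : 'rV[K]_2 :=
  \row_j (if j == 0 then 1 else - xi ^+ l).
Definition coroot (l : 'I_m) : 'cV[K]_2 :=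
  \col_i (if i == 0 then 1 else - xi ^- l).

Lemma refl_coroot_root l : 1%:M - refl_mx l = coroot l *m root_form l.
Proof.
apply/matrixP => i j; rewrite !mxE big_ord1 !mxE.
by case: i j => [[|[|]]] //= h [[|[|]]] //= h';
  rewrite ?mulr1 ?mul1r ?mulrNN ?sub0r ?subr0 ?mulVf ?xiX_unit.
Qed.

Lemma refl_mx2 l : refl_mx l *m refl_mx l = 1%:M.
Proof.
apply/matrixP => i j; rewrite !mxE big_ord_recl big_ord1 !mxE.
by case: i j => [[|[|]]] //= h [[|[|]]] //= h';
  rewrite ?(mul0r, mulr0, addr0, add0r) ?mulVf ?mulfV ?xiX_unit.
Qed.

Lemma refl_inv l : invmx (refl_mx l) = refl_mx l.
Proof.
by rewrite -[LHS]mulmx1 -(refl_mx2 l) mulKmx //; exact: Gmm2_unit (reflG l).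
Qed.

Lemma rootP l (f : 'rV[K]_2) :
  f - f *m invmx (refl_mx l) = pairing f (coroot l) *: root_form l.
Proof.
rewrite refl_inv -{1}[f]mulmx1 -mulmxBr refl_coroot_root mulmxA.
by rewrite [f *m _]mx11_scalar mul_scalar_mx.
Qed.

Lemma corootP l (v : 'cV[K]_2) :
  v - refl_mx l *m v = pairing (root_form l) v *: coroot l.
Proof.
rewrite -{1}[v]mul1mx -mulmxBl refl_coroot_root -mulmxA.
by rewrite [root_form l *m v]mx11_scalar mul_mx_scalar.
Qed.

Lemma reflG_inj : injective reflG.
Proof.
move=> l l' /(congr1 sval) /matrixP/(_ 0 1); rewrite !mxE /= => /eqP.
rewrite (eq_prim_root_expr xi_prim) !modn_small // => /eqP.
exact: val_inj.
Qed.

Lemma Gmm2_cases (g : Gmm2 K m) :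
  (exists l, g = reflG l) \/
  (exists2 a : K, a ^+ m = 1 & sval g = \matrix_(i, j)
     (if i == j then if i == 0 then a else a^-1 else 0)).
Proof.
case: g => g gG /=; have /in_Gmm2P[s [g1 g2 g3 g4]] := gG.
have g4' : g 0 (s 0) * g 1 (s 1) = 1.
  by rewrite -g4 big_ord_recl big_ord1; congr (_ * g _ (s _)); exact: val_inj.
have nz : g 0 (s 0) != 0 by [].
have g1E : g 1 (s 1) = (g 0 (s 0))^-1 by rewrite -[LHS](mulKf nz) g4' mulr1.
have ord2 (i : 'I_2) : i = 0 \/ i = 1.
  by case: i => [[|[|]]] //= h; [left|right]; exact: val_inj.
have s01 : s 0 != s 1 by rewrite (inj_eq perm_inj).
case: (ord2 (s 0)) => s0E.
  have s1E : s 1 = 1 by case: (ord2 (s 1)) => // E1; move/eqP: s01; congruence.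
  have [n0 n1] : g 0 1 = 0 /\ g 1 0 = 0 by split; rewrite g2 // ?s0E ?s1E.
  rewrite s0E s1E in g1E; right; exists (g 0 0).
    by have := g3 0; rewrite s0E.
  apply/matrixP => i j; rewrite mxE.
  by case: (ord2 i) => ->; case: (ord2 j) => ->.
have s1E : s 1 = 0 by case: (ord2 (s 1)) => // E1; move/eqP: s01; congruence.
have [n0 n1] : g 0 0 = 0 /\ g 1 1 = 0 by split; rewrite g2 // ?s0E ?s1E.
have [l hl] := prim_rootP xi_prim (g3 0).
rewrite s0E s1E in g1E; rewrite s0E in hl; left.
exists l; apply: val_inj; apply/matrixP => i j; rewrite /= mxE -hl.
by case: (ord2 i) => ->; case: (ord2 j) => ->.
Qed.

(* The l < m index all reflections of G. *)
Lemma is_reflectionP (g : Gmm2 K m) :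
  is_reflection g <-> exists l, g = reflG l.
Proof.
split; last first.
  case=> l ->; rewrite /is_reflection /= refl_coroot_root.
  apply/eqP; rewrite eqn_leq; apply/andP; split.
    by apply: leq_trans (mulmx_max_rank _ _) _.
  rewrite lt0n mxrank_eq0; apply/eqP => /matrixP/(_ 0 0).
  by rewrite !mxE big_ord1 !mxE /= mulr1 => /eqP; rewrite oner_eq0.
case: (Gmm2_cases g) => [//|[a am gE]]; rewrite /is_reflection gE => rk.
exfalso; case: (eqVneq a 1) => [a1|na1].
  move: rk; set M := _ - _; have -> : M = 0.
    apply/matrixP => i j; rewrite !mxE a1 invr1.
    by case: eqVneq; rewrite ?if_same subrr.
  by rewrite mxrank0.
have D : 1%:M - \matrix_(i, j) (if i == j then if i == 0 then a else a^-1 else 0)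
    = diag_mx (\row_i (1 - (if i == 0 then a else a^-1))) :> 'M[K]_2.
  by apply/matrixP => i j; rewrite !mxE; case: eqVneq; rewrite ?subrr ?mulr1n.
have /mxrank_unit : 1%:M - \matrix_(i, j)
     (if i == j then if i == 0 then a else a^-1 else 0) \in @unitmx K 2.
  rewrite D unitmxE det_diag big_ord_recl big_ord1 !mxE /= unitfE.
  by rewrite mulf_neq0 // subr_eq0 eq_sym // invr_eq1.
by rewrite rk.
Qed.

End Reflections.

Section CherednikAlgebra.
Variables (K : fieldType) (m : nat) (xi : K).
Hypothesis xi_prim : m.-primitive_root xi.
Variable c : Gmm2 K m -> K.

Inductive hexpr : Type :=
  | ECst of K
  | EGrp of Gmm2 K m
  | EVec of 'cV[K]_2
  | EFun of 'rV[K]_2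
  | EAdd of hexpr & hexpr
  | EMul of hexpr & hexpr.

(* Noncommutative K-algebra expressions in the elements of G, h and h^*, modulo
   the congruence generated by the axioms of K-algebras, the relations of
   K[G] # T(h + h^* ) and the relations of the rational Cherednik algebra. *)
Inductive hrel : hexpr -> hexpr -> Prop :=
  | hrel_refl e : hrel e e
  | hrel_sym e1 e2 : hrel e1 e2 -> hrel e2 e1
  | hrel_trans e1 e2 e3 : hrel e1 e2 -> hrel e2 e3 -> hrel e1 e3
  | hrel_add e1 e2 e1' e2' :
      hrel e1 e1' -> hrel e2 e2' -> hrel (EAdd e1 e2) (EAdd e1' e2')
  | hrel_mul e1 e2 e1' e2' :
      hrel e1 e1' -> hrel e2 e2' -> hrel (EMul e1 e2) (EMul e1' e2')
  | hrel_addA e1 e2 e3 : hrel (EAdd e1 (EAdd e2 e3)) (EAdd (EAdd e1 e2) e3)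
  | hrel_addC e1 e2 : hrel (EAdd e1 e2) (EAdd e2 e1)
  | hrel_add0 e : hrel (EAdd (ECst 0) e) e
  | hrel_addN e : hrel (EAdd (EMul (ECst (-1)) e) e) (ECst 0)
  | hrel_mulA e1 e2 e3 : hrel (EMul e1 (EMul e2 e3)) (EMul (EMul e1 e2) e3)
  | hrel_mul1l e : hrel (EMul (ECst 1) e) e
  | hrel_mul1r e : hrel (EMul e (ECst 1)) e
  | hrel_mulDl e1 e2 e3 :
      hrel (EMul (EAdd e1 e2) e3) (EAdd (EMul e1 e3) (EMul e2 e3))
  | hrel_mulDr e1 e2 e3 :
      hrel (EMul e1 (EAdd e2 e3)) (EAdd (EMul e1 e2) (EMul e1 e3))
  | hrel_cstD a b : hrel (ECst (a + b)) (EAdd (ECst a) (ECst b))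
  | hrel_cstM a b : hrel (ECst (a * b)) (EMul (ECst a) (ECst b))
  | hrel_cstC a e : hrel (EMul (ECst a) e) (EMul e (ECst a))
  | hrel_grp1 : hrel (EGrp (Gone K m)) (ECst 1)
  | hrel_grpM g h : hrel (EGrp (Gmul g h)) (EMul (EGrp g) (EGrp h))
  | hrel_vec a v w :
      hrel (EVec (a *: v + w)) (EAdd (EMul (ECst a) (EVec v)) (EVec w))
  | hrel_fun a f f' :
      hrel (EFun (a *: f + f')) (EAdd (EMul (ECst a) (EFun f)) (EFun f'))
  | hrel_grp_vec g v :
      hrel (EMul (EGrp g) (EVec v)) (EMul (EVec (sval g *m v)) (EGrp g))
  | hrel_grp_fun g f :
      hrel (EMul (EGrp g) (EFun f)) (EMul (EFun (f *m invmx (sval g))) (EGrp g))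
  | hrel_vecC v w : hrel (EMul (EVec v) (EVec w)) (EMul (EVec w) (EVec v))
  | hrel_funC f f' : hrel (EMul (EFun f) (EFun f')) (EMul (EFun f') (EFun f))
  | hrel_vec_fun v f :
      hrel (EMul (EVec v) (EFun f))
           (EAdd (EMul (EFun f) (EVec v))
              (\big[EAdd/ECst 0]_(l < m)
                 EMul (ECst (- (c (reflG xi_prim l) * pairing (root_form xi l) v
                                 * pairing f (coroot xi l))))
                      (EGrp (reflG xi_prim l)))).

HB.instance Definition _ := gen_eqMixin hexpr.
HB.instance Definition _ := gen_choiceMixin hexpr.

Definition hrelb (e1 e2 : hexpr) : bool := `[< hrel e1 e2 >].

Lemma hrelb_refl : reflexive hrelb.
Proof. by move=> e; apply/asboolP; exact: hrel_refl. Qed.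
Lemma hrelb_sym : ssrbool.symmetric hrelb.
Proof. by move=> e1 e2; apply/asboolP/asboolP; exact: hrel_sym. Qed.
Lemma hrelb_trans : transitive hrelb.
Proof.
by move=> e2 e1 e3 /asboolP h1 /asboolP h2; apply/asboolP; exact: hrel_trans h2.
Qed.

Canonical hrelb_equiv := EquivRel hrelb hrelb_refl hrelb_sym hrelb_trans.

Definition cherednik : Type := {eq_quot hrelb_equiv}.
HB.instance Definition _ := Choice.on cherednik.
HB.instance Definition _ := EqQuotient.on cherednik.

Definition hclass (e : hexpr) : cherednik := \pi_cherednik e.

Lemma hclassP e1 e2 : hclass e1 = hclass e2 <-> hrel e1 e2.
Proof.
split=> [/eqmodP/asboolP //|h]; apply/eqmodP; exact/asboolP.
Qed.

Lemma hreprK (x : cherednik) : hclass (repr x) = x. Proof. exact: reprK. Qed.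

Lemma hrepr_rel e : hrel (repr (hclass e)) e.
Proof. by apply/hclassP; rewrite hreprK. Qed.

Definition hzero := hclass (ECst 0).
Definition hone := hclass (ECst 1).
Definition hadd (x y : cherednik) : cherednik := hclass (EAdd (repr x) (repr y)).
Definition hmul (x y : cherednik) : cherednik := hclass (EMul (repr x) (repr y)).
Definition hopp (x : cherednik) : cherednik := hclass (EMul (ECst (-1)) (repr x)).

Lemma haddE e1 e2 : hadd (hclass e1) (hclass e2) = hclass (EAdd e1 e2).
Proof. by apply/hclassP; apply: hrel_add; exact: hrepr_rel. Qed.
Lemma hmulE e1 e2 : hmul (hclass e1) (hclass e2) = hclass (EMul e1 e2).
Proof. by apply/hclassP; apply: hrel_mul; exact: hrepr_rel. Qed.
Lemma hoppE e : hopp (hclass e) = hclass (EMul (ECst (-1)) e).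
Proof.
by apply/hclassP; apply: hrel_mul; [exact: hrel_refl | exact: hrepr_rel].
Qed.

Lemma haddA : associative hadd.
Proof.
move=> x y z; rewrite -[x]hreprK -[y]hreprK -[z]hreprK !haddE.
by apply/hclassP; exact: hrel_addA.
Qed.
Lemma haddC : commutative hadd.
Proof. by move=> x y; apply/hclassP; exact: hrel_addC. Qed.
Lemma hadd0 : left_id hzero hadd.
Proof. by move=> x; rewrite -[x]hreprK haddE; apply/hclassP; exact: hrel_add0. Qed.
Lemma haddN : left_inverse hzero hopp hadd.
Proof.
by move=> x; rewrite -[x]hreprK hoppE haddE; apply/hclassP; exact: hrel_addN.
Qed.
Lemma hmulA : associative hmul.
Proof.
move=> x y z; rewrite -[x]hreprK -[y]hreprK -[z]hreprK !hmulE.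
by apply/hclassP; exact: hrel_mulA.
Qed.
Lemma hmul1l : left_id hone hmul.
Proof. by move=> x; rewrite -[x]hreprK hmulE; apply/hclassP; exact: hrel_mul1l. Qed.
Lemma hmul1r : right_id hone hmul.
Proof. by move=> x; rewrite -[x]hreprK hmulE; apply/hclassP; exact: hrel_mul1r. Qed.
Lemma hmulDl : left_distributive hmul hadd.
Proof.
move=> x y z; rewrite -[x]hreprK -[y]hreprK -[z]hreprK !(haddE, hmulE).
by apply/hclassP; exact: hrel_mulDl.
Qed.
Lemma hmulDr : right_distributive hmul hadd.
Proof.
move=> x y z; rewrite -[x]hreprK -[y]hreprK -[z]hreprK !(haddE, hmulE).
by apply/hclassP; exact: hrel_mulDr.
Qed.

HB.instance Definition _ :=
  GRing.isZmodule.Build cherednik haddA haddC hadd0 haddN.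
HB.instance Definition _ :=
  GRing.Zmodule_isPzRing.Build cherednik hmulA hmul1l hmul1r hmulDl hmulDr.

Definition Hcst (a : K) : cherednik := hclass (ECst a).
Definition Hgrp (g : Gmm2 K m) : cherednik := hclass (EGrp g).
Definition Hvec (v : 'cV[K]_2) : cherednik := hclass (EVec v).
Definition Hfun (f : 'rV[K]_2) : cherednik := hclass (EFun f).

End CherednikAlgebra.

(* linform, subst_mx and divdiff are locked only to keep conversion fast. *)
HB.lock Definition linform (K : fieldType) (f : 'rV[K]_2) : {mpoly K[2]} :=
  \sum_j f 0 j *: 'X_j.

HB.lock Definition subst_mx (K : fieldType) (N : 'M[K]_2) (p : {mpoly K[2]}) :
    {mpoly K[2]} :=
  p \mPo [tuple linform (row i N) | i < 2].

Section PolynomialAction.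
Variable K : fieldType.
Local Notation A := {mpoly K[2]}.


Lemma linformE (f : 'rV[K]_2) : linform f = \sum_j f 0 j *: 'X_j.
Proof. by rewrite unlock. Qed.

Lemma linformD (f f' : 'rV[K]_2) : linform (f + f') = linform f + linform f'.
Proof.
by rewrite !linformE -big_split; apply: eq_bigr => j _; rewrite mxE scalerDl.
Qed.
Lemma linformZ a (f : 'rV[K]_2) : linform (a *: f) = a *: linform f.
Proof.
by rewrite !linformE scaler_sumr; apply: eq_bigr => j _; rewrite mxE scalerA.
Qed.
Lemma linformB (f f' : 'rV[K]_2) : linform (f - f') = linform f - linform f'.
Proof. by rewrite linformD -scaleN1r linformZ scaleN1r. Qed.
Lemma linform_delta i : linform (delta_mx 0 i) = 'X_i :> A.
Proof.
rewrite linformE (bigD1 i) //= big1 ?addr0 ?mxE ?eqxx ?scale1r // => j nj.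
by rewrite mxE (negPf nj) scale0r.
Qed.

Lemma subst_linform (N : 'M[K]_2) f : subst_mx N (linform f) = linform (f *m N).
Proof.
rewrite unlock !linformE raddf_sum /=.
under eq_bigr => j _ do
  rewrite comp_mpolyZ comp_mpolyXU -tnth_nth tnth_mktuple linformE scaler_sumr.
rewrite exchange_big; apply: eq_bigr => j _ /=; rewrite mxE scaler_suml.
by apply: eq_bigr => i _; rewrite scalerA mxE.
Qed.

Lemma subst_mxM (N : 'M[K]_2) p q : subst_mx N (p * q) = subst_mx N p * subst_mx N q.
Proof. by rewrite unlock; exact: rmorphM. Qed.
Lemma subst_mxP (N : 'M[K]_2) a p q : subst_mx N (a *: p + q) = a *: subst_mx N p + subst_mx N q.
Proof. by rewrite unlock; exact: linearP. Qed.
Lemma subst_mxC (N : 'M[K]_2) a : subst_mx N a%:MP = a%:MP.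
Proof. by rewrite unlock; exact: comp_mpolyC. Qed.

Lemma mpoly_alg_ind (P : A -> Prop) :
  (forall a p q, P p -> P q -> P (a *: p + q)) -> P 1 ->
  (forall p q, P p -> P q -> P (p * q)) -> (forall i, P 'X_i) -> forall p, P p.
Proof.
move=> PD P1 PM PX p.
have P0 : P 0 by rewrite -(subrr 1) addrC -scaleN1r; exact: PD.
rewrite [p]mpolyE; elim/big_ind: _ => //.
- by move=> x y Px Py; rewrite -[x]scale1r; exact: PD.
- move=> mon _; rewrite -[_ *: _]addr0; apply: PD => //.
  rewrite mpolyXE_id; elim/big_ind: _ => // i _.
  by elim: (mon i) => [|k IH]; rewrite ?expr0 ?exprS //; exact: PM.
Qed.

Lemma subst_mx_comp (N N' : 'M[K]_2) p : subst_mx N (subst_mx N' p) = subst_mx (N' *m N) p.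
Proof.
elim/mpoly_alg_ind: p => [a p q hp hq||p q hp hq|i].
- by rewrite !subst_mxP hp hq.
- by rewrite -mpolyC1 !subst_mxC.
- by rewrite !subst_mxM hp hq.
- by rewrite -linform_delta !subst_linform mulmxA.
Qed.

Lemma subst_mx1 (p : A) : subst_mx 1%:M p = p.
Proof.
elim/mpoly_alg_ind: p => [a p q hp hq||p q hp hq|i].
- by rewrite !subst_mxP hp hq.
- by rewrite -mpolyC1 !subst_mxC.
- by rewrite !subst_mxM hp hq.
- by rewrite -linform_delta !subst_linform mulmx1.
Qed.

Variable m : nat.

Definition actA (g : Gmm2 K m) : A -> A := subst_mx (invmx (sval g)).

Lemma actA1 p : actA (Gone K m) p = p.
Proof. by rewrite /actA /= invmx1 subst_mx1. Qed.

Lemma invmxM (g h : Gmm2 K m) :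
  invmx (sval g *m sval h) = invmx (sval h) *m invmx (sval g).
Proof.
have gu := Gmm2_unit g; have hu := Gmm2_unit h.
have ghu : sval g *m sval h \in unitmx by rewrite unitmx_mul gu.
rewrite -[RHS]mul1mx -(mulVmx ghu) -[LHS]mulmx1 -!mulmxA; congr (_ *m _).
by rewrite mulKVmx // mulmxV.
Qed.

Lemma actAM g h p : actA (Gmul g h) p = actA g (actA h p).
Proof. by rewrite /actA subst_mx_comp /= invmxM. Qed.

End PolynomialAction.

Section Representations.
Variables (K : fieldType) (m : nat).

(* A representation of G on K^n, acting on the left of column vectors. *)
Record grep n := Grep {
  grep_mx :> Gmm2 K m -> 'M[K]_n;
  grep1 : grep_mx (Gone K m) = 1%:M;
  grepM : forall g h, grep_mx (Gmul g h) = grep_mx g *m grep_mx h }.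

(* Entries to the i-th power in the action x_j |-> \sum_k (g^-1)_(j, k) x_k of g
   on h^*: the reflection x |-> a y, y |-> a^-1 x acts by e_1 |-> a^i e_2,
   e_2 |-> a^-i e_1. *)
Definition rho_mx (i : nat) (g : Gmm2 K m) : 'M[K]_2 :=
  (map_mx (fun a => a ^+ i) (invmx (sval g)))^T.

Variable i : nat.
Hypothesis i_gt0 : (0 < i)%N.

Lemma monomial_invmx n (g : 'M[K]_n) (s : 'S_n) :
  g \in unitmx -> (forall k, g k (s k) != 0) ->
  (forall k j, j != s k -> g k j = 0) ->
  forall k j, invmx g k j = if k == s j then (g j k)^-1 else 0.
Proof.
move=> gu g1 g2; pose h := \matrix_(i, j) (if i == s j then (g j i)^-1 else 0).
suff E : g *m h = 1%:M.
  by move=> k j; rewrite -[invmx g]mulmx1 -E mulKmx // mxE.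
apply/matrixP=> k j; rewrite !mxE (bigD1 (s k)) //= big1 ?addr0; last first.
  by move=> l nl; rewrite g2 // mul0r.
rewrite mxE (inj_eq perm_inj); case: eqVneq => [->|]; last by rewrite mulr0.
by rewrite mulfV.
Qed.

Lemma rho_subproof1 : rho_mx i (Gone K m) = 1%:M.
Proof.
apply/matrixP => a b; rewrite /rho_mx /= invmx1 !mxE eq_sym.
by case: eqVneq; rewrite ?expr1n // expr0n -(prednK i_gt0).
Qed.

Lemma rho_subproofM g h : rho_mx i (Gmul g h) = rho_mx i g *m rho_mx i h.
Proof.
rewrite /rho_mx -trmx_mul; congr trmx; rewrite invmxM.
have gu := Gmm2_unit g; have hu := Gmm2_unit h.
have /in_Gmm2P[s [g1 g2 _ _]] := svalP g; have /in_Gmm2P[t [h1 h2 _ _]] := svalP h.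
have gE := monomial_invmx gu g1 g2; have hE := monomial_invmx hu h1 h2.
apply/matrixP => a b; rewrite !mxE (bigD1 (s b)) //= [RHS](bigD1 (s b)) //=.
have e0 : (0 : K) ^+ i = 0 by rewrite expr0n -(prednK i_gt0).
rewrite !big1 ?addr0.
- by rewrite !mxE exprMn.
- by move=> j nj; rewrite ?mxE gE (negPf nj) ?e0 mulr0.
- by move=> j nj; rewrite ?mxE gE (negPf nj) ?e0 mulr0.
Qed.

Definition rho : grep 2 := Grep rho_subproof1 rho_subproofM.

End Representations.

Section RootDivision.
Variables (K : fieldType) (m : nat) (xi : K).
Hypothesis xi_prim : m.-primitive_root xi.
Local Notation A := {mpoly K[2]}.
Local Notation s_ := (reflG xi_prim).

Lemma actA_linform g f : actA g (linform f) = linform (f *m invmx (sval (g : Gmm2 K m))).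
Proof. exact: subst_linform. Qed.

Lemma mpscale (a : K) (p q : A) : p * (a *: q) = a *: (p * q).
Proof. by rewrite scalerAr. Qed.

Lemma actAP g a p q : actA (g : Gmm2 K m) (a *: p + q) = a *: actA g p + actA g q.
Proof. exact: subst_mxP. Qed.
Lemma actA_mul g p q : actA (g : Gmm2 K m) (p * q) = actA g p * actA g q.
Proof. exact: subst_mxM. Qed.
Lemma actAC g a : actA (g : Gmm2 K m) a%:MP = a%:MP.
Proof. exact: subst_mxC. Qed.

Lemma root_dvd l p :
  exists q : A, linform (root_form xi l) * q == p - actA (s_ l) p.
Proof.
elim/mpoly_alg_ind: p => [a p p' [q /eqP hq] [q' /eqP hq']||p p' [q /eqP hq] [q' /eqP hq']|i].
- exists (a *: q + q'); rewrite actAP mulrDr mpscale hq hq'.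
  by rewrite scalerBr opprD addrACA.
- by exists 0; rewrite mulr0 -mpolyC1 actAC subrr.
- exists (p * q' + q * actA (s_ l) p'); apply/eqP.
  rewrite mulrDr mulrCA hq' mulrA hq actA_mul mulrBr mulrBl.
  by rewrite addrA subrK.
- rewrite -linform_delta; exists (pairing (delta_mx 0 i) (coroot xi l))%:MP.
  by rewrite actA_linform -linformB (rootP xi_prim) linformZ mulrC mul_mpolyC.
Qed.

End RootDivision.

(* ((1 - s) p) / alpha_s *)
HB.lock Definition divdiff (K : fieldType) (m : nat) (xi : K)
    (xi_prim : m.-primitive_root xi) (l : 'I_m) (p : {mpoly K[2]}) : {mpoly K[2]} :=
  xchoose (root_dvd xi_prim l p).

Lemma zmod_aux (W : zmodType) (a b y1 y2 x z : W) :
  x - y2 = z - y1 -> a + y1 + x - (b + y2 + z) = a - b.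
Proof.
move/eqP; rewrite subr_eq => /eqP ->.
have -> : a + y1 + (z - y1 + y2) = a + (y2 + z).
  rewrite -addrA; congr (_ + _).
  by rewrite -addrA addrCA [y1 + _]addrA subrr add0r addrC.
by rewrite -[b + y2 + z]addrA opprD addrACA subrr addr0.
Qed.

Section Verma.
Variables (K : fieldType) (m : nat) (xi : K).
Hypothesis xi_prim : m.-primitive_root xi.
Variable c : Gmm2 K m -> K.
Hypothesis c_class : class_fun c.
Variables (n : nat) (tau : grep K m n).

Local Notation A := {mpoly K[2]}.
Local Notation V := {ffun 'I_n -> A}.
Local Notation s_ := (reflG xi_prim).
Local Notation divdiff := (divdiff xi_prim).

Lemma divdiffE l p : linform (root_form xi l) * divdiff l p = p - actA (s_ l) p.
Proof. by rewrite divdiff.unlock; apply/eqP; exact: (xchooseP (root_dvd xi_prim l p)). Qed.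

Lemma linform_root_neq0 (l : 'I_m) : linform (root_form xi l) != 0.
Proof.
apply/eqP => /(congr1 (meval (fun j : 'I_2 => (j == 0)%:R))).
rewrite meval0 linformE raddf_sum big_ord_recl big_ord1 /= !mevalZ !mevalXU !mxE.
by rewrite /= mulr1 mulr0 addr0 => /eqP; rewrite oner_eq0.
Qed.

Lemma divdiff_uniq l p q :
  linform (root_form xi l) * q = p - actA (s_ l) p -> divdiff l p = q.
Proof. by rewrite -divdiffE => /(mulfI (linform_root_neq0 l)). Qed.

Lemma divdiffP l a p q : divdiff l (a *: p + q) = a *: divdiff l p + divdiff l q.
Proof.
apply: divdiff_uniq; rewrite mulrDr mpscale (divdiffE l p) (divdiffE l q) actAP.
by rewrite scalerBr opprD addrACA.
Qed.

Lemma divdiffC l a : divdiff l a%:MP = 0.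
Proof. by apply: divdiff_uniq; rewrite mulr0 actAC subrr. Qed.

Lemma divdiff_linform l f p :
  divdiff l (linform f * p)
  = linform f * divdiff l p + pairing f (coroot xi l) *: actA (s_ l) p.
Proof.
apply: divdiff_uniq; rewrite mulrDr mulrCA [_ * divdiff l p]divdiffE mpscale.
rewrite scalerAl -linformZ -(rootP xi_prim) linformB actA_mul.
rewrite actA_linform mulrBr mulrBl.
by rewrite addrA subrK.
Qed.

Definition verma_cst (a : K) (u : V) : V := a *: u.
Definition verma_poly (p : A) (u : V) : V := [ffun k => p * u k].
Definition verma_grp (g : Gmm2 K m) (u : V) : V :=
  [ffun k => \sum_j tau g k j *: actA g (u j)].
Definition dunkl (v : 'cV[K]_2) (u : V) : V :=
  - \sum_(l < m) (c (s_ l) * pairing (root_form xi l) v) *: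
      [ffun k => \sum_j tau (s_ l) k j *: divdiff l (u j)].

Definition vmat (N : 'M[K]_n) (u : V) : V := [ffun k => \sum_j N k j *: u j].
Definition vmap (F : A -> A) (u : V) : V := [ffun k => F (u k)].

Lemma vmatP N a u v : vmat N (a *: u + v) = a *: vmat N u + vmat N v.
Proof.
apply/ffunP => k; rewrite !ffunE scaler_sumr -big_split /=.
apply: eq_bigr => j _; rewrite !ffunE scalerDr !scalerA; congr (_ *: _ + _).
exact: mulrC.
Qed.

Lemma vmatM N N' u : vmat (N *m N') u = vmat N (vmat N' u).
Proof.
apply/ffunP => k; rewrite !ffunE.
under [RHS]eq_bigr => j _ do rewrite ffunE scaler_sumr.
rewrite exchange_big; apply: eq_bigr => i _ /=; rewrite mxE scaler_suml.
by apply: eq_bigr => j _; rewrite scalerA.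
Qed.

Lemma vmat1 u : vmat 1%:M u = u.
Proof.
apply/ffunP => k; rewrite !ffunE (bigD1 k) //= big1 ?addr0 ?mxE ?eqxx ?scale1r //.
by move=> j nj; rewrite mxE eq_sym (negPf nj) scale0r.
Qed.

Definition klin (F : A -> A) := forall a p q, F (a *: p + q) = a *: F p + F q.

Lemma klin0 F : klin F -> F 0 = 0.
Proof.
by move=> h; have := h (-1) 0 0; rewrite scaler0 addr0 scaleN1r => ->; rewrite addNr.
Qed.
Lemma klinD F : klin F -> forall p q, F (p + q) = F p + F q.
Proof. by move=> h p q; rewrite -[p in LHS]scale1r h scale1r. Qed.
Lemma klinZ F : klin F -> forall a p, F (a *: p) = a *: F p.
Proof. by move=> h a p; rewrite -[_ *: p]addr0 h (klin0 h) addr0. Qed.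
Lemma klin_sum F : klin F -> forall (f : 'I_n -> A), F (\sum_j f j) = \sum_j F (f j).
Proof. by move=> h f; apply: big_morph; [exact: klinD | exact: klin0]. Qed.

Lemma klin_actA (g : Gmm2 K m) : klin (actA g).
Proof. by move=> a p q; exact: actAP. Qed.
Lemma klin_divdiff l : klin (divdiff l).
Proof. by move=> a p q; exact: divdiffP. Qed.

Lemma vmapP F (hF : klin F) a u v : vmap F (a *: u + v) = a *: vmap F u + vmap F v.
Proof. by apply/ffunP => k; rewrite !ffunE hF. Qed.

Lemma vmap_vmat F (hF : klin F) N u : vmap F (vmat N u) = vmat N (vmap F u).
Proof.
apply/ffunP => k; rewrite !ffunE klin_sum //.
by apply: eq_bigr => j _; rewrite ffunE klinZ.
Qed.

Lemma vmatE N u k : vmat N u k = \sum_j N k j *: u j.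
Proof. exact: ffunE. Qed.
Lemma vmapE F u k : vmap F u k = F (u k).
Proof. exact: ffunE. Qed.

Lemma verma_grpE g u : verma_grp g u = vmat (tau g) (vmap (actA g) u).
Proof.
by apply/ffunP => k; rewrite !ffunE; apply: eq_bigr => j _; rewrite ffunE.
Qed.

Lemma dunklE v u : dunkl v u = - \sum_(l < m)
  (c (s_ l) * pairing (root_form xi l) v) *: vmat (tau (s_ l)) (vmap (divdiff l) u).
Proof.
congr (- _); apply: eq_bigr => l _; congr (_ *: _).
by apply/ffunP => k; rewrite !ffunE; apply: eq_bigr => j _; rewrite ffunE.
Qed.

Lemma vmat0 N : vmat N 0 = 0.
Proof. by have := vmatP N (-1) 0 0; rewrite scaler0 addr0 scaleN1r => ->; rewrite addNr. Qed.

Lemma verma_grpP g a u v :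
  verma_grp g (a *: u + v) = a *: verma_grp g u + verma_grp g v.
Proof. by rewrite !verma_grpE (vmapP (klin_actA g)) vmatP. Qed.

Lemma dunklP w a u v : dunkl w (a *: u + v) = a *: dunkl w u + dunkl w v.
Proof.
rewrite !dunklE scalerN -opprD scaler_sumr -big_split; congr (- _).
apply: eq_bigr => l _; rewrite (vmapP (@klin_divdiff l)) vmatP scalerDr !scalerA.
by congr (_ *: _ + _); exact: mulrC.
Qed.

Lemma verma_polyP p a u v :
  verma_poly p (a *: u + v) = a *: verma_poly p u + verma_poly p v.
Proof. by apply/ffunP => k; rewrite !ffunE mulrDr -scalerAr. Qed.

Lemma dunkl_vecP a v w u : dunkl (a *: v + w) u = a *: dunkl v u + dunkl w u.
Proof.
rewrite !dunklE scalerN -opprD scaler_sumr -big_split; congr (- _).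
apply: eq_bigr => l _; rewrite pairingDr pairingZr mulrDr scalerDl scalerA.
by rewrite mulrCA.
Qed.

Lemma verma_poly_linP a f f' u :
  verma_poly (linform (a *: f + f')) u
  = a *: verma_poly (linform f) u + verma_poly (linform f') u.
Proof.
by apply/ffunP => k; rewrite !ffunE linformD linformZ mulrDl scalerAl.
Qed.

Lemma verma_polyC p q u : verma_poly p (verma_poly q u) = verma_poly q (verma_poly p u).
Proof. by apply/ffunP => k; rewrite !ffunE mulrCA. Qed.

Lemma verma_grp1 u : verma_grp (Gone K m) u = u.
Proof.
by rewrite verma_grpE grep1 vmat1; apply/ffunP => k; rewrite vmapE actA1.
Qed.

Lemma verma_grpM g h u : verma_grp (Gmul g h) u = verma_grp g (verma_grp h u).
Proof.
rewrite !verma_grpE grepM vmatM (vmap_vmat (klin_actA g)); congr (vmat _ (vmat _ _)).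
by apply/ffunP => k; rewrite !vmapE actAM.
Qed.

Lemma verma_grp_poly g p u :
  verma_grp g (verma_poly p u) = verma_poly (actA g p) (verma_grp g u).
Proof.
apply/ffunP => k; rewrite !ffunE mulr_sumr; apply: eq_bigr => j _.
by rewrite ffunE mpscale actA_mul.
Qed.

Lemma dunkl_poly v f u :
  dunkl v (verma_poly (linform f) u) = verma_poly (linform f) (dunkl v u)
   + \sum_(l < m) - (c (s_ l) * pairing (root_form xi l) v * pairing f (coroot xi l))
       *: verma_grp (s_ l) u.
Proof.
have -> : verma_poly (linform f) (dunkl v u) = - \sum_(l < m)
    (c (s_ l) * pairing (root_form xi l) v) *:
     verma_poly (linform f) (vmat (tau (s_ l)) (vmap (divdiff l) u)).
  rewrite dunklE; apply/ffunP => k; rewrite !ffunE mulrN !sum_ffunE mulr_sumr.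
  by congr (- _); apply: eq_bigr => l _; rewrite !ffunE mpscale.
rewrite dunklE -!sumrN -big_split; apply: eq_bigr => l _ /=.
rewrite scaleNr -opprD; congr (- _); rewrite -[_ *: verma_grp _ _]scalerA -scalerDr; congr (_ *: _).
apply/ffunP => k; rewrite vmatE !ffunE ?vmatE mulr_sumr scaler_sumr -big_split.
apply: eq_bigr => j _ /=; rewrite 2!vmapE [verma_poly _ _ _]ffunE divdiff_linform scalerDr mpscale.
by rewrite !scalerA [tau _ _ _ * _]mulrC.
Qed.

Lemma Ginv_ex (g : Gmm2 K m) : exists h : Gmm2 K m, sval h = invmx (sval g).
Proof.
have gu := Gmm2_unit g.
have /in_Gmm2P[s [g1 g2 g3 g4]] := svalP g.
have gE := monomial_invmx gu g1 g2.
suff hG : in_Gmm2 m (invmx (sval g)) by exists (exist (fun x => is_true (in_Gmm2 m x)) _ hG).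
apply/in_Gmm2P; exists (s^-1)%g; split.
- by move=> i; rewrite gE permKV eqxx invr_eq0 -{2}[i](permKV s).
- move=> i j nj; rewrite gE; case: eqVneq => // ij.
  by rewrite ij permK eqxx in nj.
- by move=> i; rewrite gE permKV eqxx exprVn -{2}[i](permKV s) g3 invr1.
- rewrite (reindex_inj (@perm_inj _ s)) /=.
  rewrite (eq_bigr (fun i => (sval g i (s i))^-1)); last first.
    by move=> i _; rewrite permK gE eqxx.
  by rewrite prodfV g4 invr1.
Qed.

Lemma conj_refl_ex (g : Gmm2 K m) l : exists l', Gmul g (s_ l) == Gmul (s_ l') g.
Proof.
have [h hE] := Ginv_ex g; have gu := Gmm2_unit g.
have : is_reflection (Gmul (Gmul g (s_ l)) h).
  rewrite /is_reflection /= hE.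
  have -> : 1%:M - sval g *m refl_mx xi l *m invmx (sval g)
     = sval g *m (1%:M - refl_mx xi l) *m invmx (sval g).
    by rewrite mulmxBr mulmx1 mulmxBl mulmxV.
  rewrite mxrankMfree ?row_free_unit ?unitmx_inv //.
  rewrite -mxrank_tr trmx_mul mxrankMfree ?row_free_unit ?unitmx_tr // mxrank_tr.
  by have /(is_reflectionP xi_prim) : exists l', s_ l = s_ l' by exists l.
case/(is_reflectionP xi_prim) => l' /(congr1 sval) /= E.
exists l'; apply/eqP; apply: val_inj; rewrite /= -E hE -!mulmxA.
by rewrite mulVmx // mulmx1.
Qed.

Definition conj_refl g l := xchoose (conj_refl_ex g l).

Lemma conj_reflE g l : Gmul g (s_ l) = Gmul (s_ (conj_refl g l)) g.
Proof. by apply/eqP; exact: (xchooseP (conj_refl_ex g l)). Qed.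

Lemma conj_refl_inj g : injective (conj_refl g).
Proof.
move=> l l' E; apply: (reflG_inj (xi_prim := xi_prim)); apply: val_inj => /=.
have /(congr1 sval) /= := conj_reflE g l; rewrite E.
have /(congr1 sval) /= <- := conj_reflE g l'.
by move/(can_inj (mulKmx (Gmm2_unit g))).
Qed.

Lemma conj_root g l : exists2 mu : K, mu != 0 &
  root_form xi (conj_refl g l) = mu *: (root_form xi l *m invmx (sval g)).
Proof.
set l' := conj_refl g l; have gu := Gmm2_unit g.
have E : coroot xi l' *m root_form xi l'
    = sval g *m coroot xi l *m (root_form xi l *m invmx (sval g)).
  rewrite mulmxA -[sval g *m _ *m _]mulmxA -!(refl_coroot_root xi_prim).
  have /(congr1 sval) /= sE := conj_reflE g l.
  by rewrite mulmxBr mulmx1 sE mulmxBl mulmxV // mulmxK.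
have rE : root_form xi l' =
    (sval g *m coroot xi l) 0 0 *: (root_form xi l *m invmx (sval g)).
  apply/rowP => j; have /matrixP/(_ 0 j) := E.
  by rewrite mxE big_ord1 [X in X * _ = _]mxE /= mul1r => ->; rewrite [LHS]mxE big_ord1 [RHS]mxE.
eexists; last exact: rE; apply/eqP => z; move: rE; rewrite z scale0r.
by move/matrixP/(_ 0 0); rewrite !mxE /= => /eqP; rewrite oner_eq0.
Qed.

Lemma divdiff_conj g l p v :
  pairing (root_form xi (conj_refl g l)) (sval g *m v)
     *: divdiff (conj_refl g l) (actA g p)
  = pairing (root_form xi l) v *: actA g (divdiff l p).
Proof.
have [mu mu0 rE] := conj_root g l; set l' := conj_refl g l in rE *.
have -> : pairing (root_form xi l') (sval g *m v) = mu * pairing (root_form xi l) v.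
  by rewrite rE pairingZl /pairing mulmxA mulmxKV // Gmm2_unit.
rewrite mulrC -scalerA; congr (_ *: _).
have gA0 : linform (root_form xi l *m invmx (sval g)) != 0.
  apply/eqP => z; have := linform_root_neq0 l'.
  by rewrite rE linformZ z scaler0 eqxx.
apply: (mulfI gA0); rewrite mpscale scalerAl -linformZ -rE divdiffE.
rewrite -actA_linform -actA_mul divdiffE.
rewrite -[- actA (s_ l) p]scaleN1r [p + _]addrC klin_actA scaleN1r addrC.
by congr (- _ + _); rewrite -[LHS]actAM -[RHS]actAM conj_reflE.
Qed.

Lemma dunkl_grp g v u :
  verma_grp g (dunkl v u) = dunkl (sval g *m v) (verma_grp g u).
Proof.
have gP := verma_grpP g.
have g0 : verma_grp g 0 = 0.
  by have := gP (-1) 0 0; rewrite scaler0 addr0 scaleN1r => ->; rewrite addNr.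
have gD u1 u2 : verma_grp g (u1 + u2) = verma_grp g u1 + verma_grp g u2.
  by rewrite -[u1 in LHS]scale1r gP scale1r.
have gZ a u1 : verma_grp g (a *: u1) = a *: verma_grp g u1.
  by rewrite -[_ *: u1]addr0 gP g0 addr0.
have gN u1 : verma_grp g (- u1) = - verma_grp g u1 by rewrite -scaleN1r gZ scaleN1r.
rewrite !dunklE gN (big_morph _ gD g0); congr (- _).
rewrite [RHS](reindex_inj (@conj_refl_inj g)); apply: eq_bigr => l _.
set l' := conj_refl g l.
have <- : c (s_ l) = c (s_ l').
  apply: c_class; first by apply/(is_reflectionP xi_prim); exists l.
  by exists g; exact: conj_reflE.
rewrite gZ.
have -> : verma_grp g (vmat (tau (s_ l)) (vmap (divdiff l) u))
    = vmat (tau (Gmul g (s_ l))) (vmap (actA g) (vmap (divdiff l) u)).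
  by rewrite verma_grpE (vmap_vmat (klin_actA g)) -vmatM grepM.
have -> : vmat (tau (s_ l')) (vmap (divdiff l') (verma_grp g u))
    = vmat (tau (Gmul (s_ l') g)) (vmap (divdiff l') (vmap (actA g) u)).
  by rewrite verma_grpE (vmap_vmat (@klin_divdiff l')) -vmatM grepM.
rewrite conj_reflE -[LHS]scalerA -[RHS]scalerA; congr (_ *: _).
rewrite -/l'; set N := tau _; move: N => N.
have vZ a w : a *: vmat N w = vmat N (a *: w).
  by have := vmatP N a w 0; rewrite addr0 => ->; rewrite vmat0 addr0.
rewrite 2!vZ; congr (vmat _ _); apply/ffunP => k.
transitivity (pairing (root_form xi l) v *: actA g (divdiff l (u k))).
  by rewrite ffunE 2!vmapE.
by rewrite -divdiff_conj [RHS]ffunE 2!vmapE.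
Qed.

Lemma dunkl0 v : dunkl v 0 = 0.
Proof.
by have := dunklP v (-1) 0 0; rewrite scaler0 addr0 scaleN1r => ->; rewrite addNr.
Qed.
Lemma dunklD v u1 u2 : dunkl v (u1 + u2) = dunkl v u1 + dunkl v u2.
Proof. by rewrite -[u1 in LHS]scale1r dunklP scale1r. Qed.
Lemma dunklZ v a u : dunkl v (a *: u) = a *: dunkl v u.
Proof. by rewrite -[_ *: u]addr0 dunklP dunkl0 addr0. Qed.

Let resid v f u := \sum_(l < m)
  - (c (s_ l) * pairing (root_form xi l) v * pairing f (coroot xi l))
       *: verma_grp (s_ l) u.

Let dunkl_resid v w f u : dunkl v (resid w f u) - resid w f (dunkl v u) =
  \sum_(l < m) (c (s_ l) * pairing (root_form xi l) v * pairing (root_form xi l) w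
    * pairing f (coroot xi l)) *: verma_grp (s_ l) (dunkl (coroot xi l) u).
Proof.
rewrite (big_morph _ (@dunklD v) (dunkl0 v)) -sumrB; apply: eq_bigr => l _.
rewrite dunklZ -scalerBr.
have -> : dunkl v (verma_grp (s_ l) u)
    = verma_grp (s_ l) (dunkl (refl_mx xi l *m v) u).
  by rewrite dunkl_grp mulmxA /= (refl_mx2 xi_prim) mul1mx.
have -> : refl_mx xi l *m v = (- pairing (root_form xi l) v) *: coroot xi l + v.
  by rewrite scaleNr -(corootP xi_prim) opprB subrK.
by rewrite dunkl_vecP verma_grpP addrK scalerA mulrNN; congr (_ *: _); rewrite mulrC !mulrA [_ * c _]mulrC.
Qed.

Lemma dunklC v w u : dunkl v (dunkl w u) = dunkl w (dunkl v u).
Proof.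
pose C u := dunkl v (dunkl w u) - dunkl w (dunkl v u).
have CP a u1 u2 : C (a *: u1 + u2) = a *: C u1 + C u2.
  by rewrite /C !dunklP scalerBr opprD addrACA.
have C0 : C 0 = 0 by rewrite /C !dunkl0 subrr.
have CD u1 u2 : C (u1 + u2) = C u1 + C u2 by rewrite -[u1 in LHS]scale1r CP scale1r.
have Cf f u1 : C (verma_poly (linform f) u1) = verma_poly (linform f) (C u1).
  have pB u2 u3 : verma_poly (linform f) (u2 - u3)
     = verma_poly (linform f) u2 - verma_poly (linform f) u3.
    by rewrite -scaleN1r addrC verma_polyP scaleN1r addrC.
  have E := dunkl_resid v w f u1; have E' := dunkl_resid w v f u1.
  have {E'}E : dunkl v (resid w f u1) - resid w f (dunkl v u1)
     = dunkl w (resid v f u1) - resid v f (dunkl w u1).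
    rewrite [LHS]E [RHS]E'; apply: eq_bigr => l _.
    by rewrite (mulrAC (c (s_ l)) (pairing (root_form xi l) v)).
  have D v' w' : dunkl v' (dunkl w' (verma_poly (linform f) u1))
      = verma_poly (linform f) (dunkl v' (dunkl w' u1)) + resid v' f (dunkl w' u1)
        + dunkl v' (resid w' f u1).
    by rewrite dunkl_poly -/(resid w' f u1) dunklD dunkl_poly.
  by rewrite /C pB (D v w) (D w v); exact: zmod_aux.
have Cp p : forall u1, C (verma_poly p u1) = verma_poly p (C u1).
  elim/mpoly_alg_ind: p => [a p q hp hq u1|u1|p q hp hq u1|i u1].
  - have E u2 : verma_poly (a *: p + q) u2 = a *: verma_poly p u2 + verma_poly q u2.
      by apply/ffunP => k; rewrite !ffunE mulrDl scalerAl.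
    by rewrite !E CP hp hq.
  - have E u2 : verma_poly 1 u2 = u2 by apply/ffunP => k; rewrite ffunE mul1r.
    by rewrite !E.
  - have E u2 : verma_poly (p * q) u2 = verma_poly p (verma_poly q u2).
      by apply/ffunP => k; rewrite !ffunE mulrA.
    by rewrite !E hp hq.
  - by rewrite -linform_delta Cf.
suff Cu : C u = 0 by apply/eqP; rewrite -subr_eq0; apply/eqP; exact: Cu.
pose e j : V := [ffun k => (k == j)%:R%:MP].
have De w' j : dunkl w' (e j) = 0.
  rewrite dunklE big1 ?oppr0 // => l _; set u' := vmap _ _.
  have -> : u' = 0 by apply/ffunP => k; rewrite vmapE !ffunE divdiffC.
  by rewrite vmat0 scaler0.
have Ce j : C (e j) = 0 by rewrite /C !De !dunkl0 subrr.
have uE : u = \sum_j verma_poly (u j) (e j).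
  apply/ffunP => k; rewrite sum_ffunE (bigD1 k) //= big1 ?addr0.
    by rewrite !ffunE eqxx mulr1.
  by move=> j nj; rewrite !ffunE eq_sym (negPf nj) mulr0.
have -> : C u = C (\sum_j verma_poly (u j) (e j)) by rewrite -uE.
have -> : C (\sum_j verma_poly (u j) (e j)) = \sum_j C (verma_poly (u j) (e j)).
  exact: (big_morph _ CD C0).
apply: big1 => j _; rewrite Cp Ce.
by apply/ffunP => k; rewrite ffunE [RHS]ffunE ffunE mulr0.
Qed.

End Verma.

(* M(tau) = A (x) tau, the sum of the p_j (x) e_j being [ffun j => p_j]. *)
Definition verma (K : fieldType) (m : nat) (xi : K)
    (xi_prim : m.-primitive_root xi) (c : Gmm2 K m -> K) (c_class : class_fun c)
    (n : nat) (tau : grep K m n) : Type :=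
  {ffun 'I_n -> {mpoly K[2]}}.

Section VermaModule.
Variables (K : fieldType) (m : nat) (xi : K).
Hypothesis xi_prim : m.-primitive_root xi.
Variable c : Gmm2 K m -> K.
Hypothesis c_class : class_fun c.
Variables (n : nat) (tau : grep K m n).

Local Notation V := {ffun 'I_n -> {mpoly K[2]}}.
Local Notation H := (cherednik xi_prim c).

Fixpoint heval (e : hexpr K m) : V -> V :=
  match e with
  | ECst a => fun u => a *: u
  | EGrp g => verma_grp tau g
  | EVec v => dunkl xi_prim c tau v
  | EFun f => verma_poly (linform f)
  | EAdd e1 e2 => fun u => heval e1 u + heval e2 u
  | EMul e1 e2 => fun u => heval e1 (heval e2 u)
  end.

Lemma hevalP e a u v : heval e (a *: u + v) = a *: heval e u + heval e v.
Proof.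
elim: e a u v => [b|g|w|f|e1 IH1 e2 IH2|e1 IH1 e2 IH2] a u v /=.
- by rewrite scalerDr !scalerA mulrC.
- exact: verma_grpP.
- exact: dunklP.
- exact: verma_polyP.
- by rewrite IH1 IH2 scalerDr addrACA.
- by rewrite IH2 IH1.
Qed.

Lemma hevalD e u v : heval e (u + v) = heval e u + heval e v.
Proof. by rewrite -[u in LHS]scale1r hevalP scale1r. Qed.
Lemma heval0 e : heval e 0 = 0.
Proof. by apply: (addrI (heval e 0)); rewrite -hevalD !addr0. Qed.
Lemma hevalZ e a u : heval e (a *: u) = a *: heval e u.
Proof. by rewrite -[_ *: u]addr0 hevalP heval0 addr0. Qed.

Lemma heval_sum k (F : 'I_k -> hexpr K m) u :
  heval (\big[@EAdd K m/ECst m 0]_i F i) u = \sum_i heval (F i) u.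
Proof.
by apply: (big_morph (fun e => heval e u)) => //=; rewrite scale0r.
Qed.

Lemma heval_rel e1 e2 : hrel xi_prim c e1 e2 -> heval e1 =1 heval e2.
Proof.
elim=> {e1 e2} /=.
- by [].
- by move=> e1 e2 _ IH u.
- by move=> e1 e2 e3 _ IH1 _ IH2 u; rewrite IH1.
- by move=> e1 e2 e1' e2' _ IH1 _ IH2 u; rewrite IH1 IH2.
- by move=> e1 e2 e1' e2' _ IH1 _ IH2 u; rewrite IH1 IH2.
- by move=> e1 e2 e3 u; rewrite addrA.
- by move=> e1 e2 u; rewrite addrC.
- by move=> e u; rewrite scale0r add0r.
- by move=> e u; rewrite scaleN1r addNr scale0r.
- by [].
- by move=> e u; rewrite scale1r.
- by move=> e u; rewrite scale1r.
- by [].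
- by move=> e1 e2 e3 u; rewrite hevalD.
- by move=> a b u; rewrite scalerDl.
- by move=> a b u; rewrite scalerA.
- by move=> a e u; rewrite hevalZ.
- by move=> u; rewrite verma_grp1 scale1r.
- by move=> g h u; rewrite verma_grpM.
- by move=> a v w u; rewrite dunkl_vecP.
- by move=> a f f' u; rewrite verma_poly_linP.
- by move=> g v u; rewrite dunkl_grp.
- by move=> g f u; rewrite verma_grp_poly actA_linform.
- by move=> v w u; rewrite dunklC.
- by move=> f f' u; rewrite verma_polyC.
- by move=> v f u; rewrite dunkl_poly heval_sum.
Qed.

Local Notation M := (verma xi_prim c_class tau).
HB.instance Definition _ := GRing.Zmodule.copy M V.

Definition verma_scale (x : H) (u : M) : M := heval (repr x) u.

Lemma verma_scaleE e (u : M) : verma_scale (hclass xi_prim c e) u = heval e u.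
Proof. exact/heval_rel/hrepr_rel. Qed.

Lemma verma_scaleA x y (u : M) : verma_scale x (verma_scale y u) = verma_scale (x * y) u.
Proof.
by rewrite -[x]hreprK -[y]hreprK [_ * _]hmulE !verma_scaleE.
Qed.
Lemma verma_scale1 : left_id 1 verma_scale.
Proof. by move=> u; rewrite verma_scaleE /= scale1r. Qed.
Lemma verma_scaleDr : right_distributive verma_scale +%R.
Proof. by move=> x u v; exact: hevalD. Qed.
Lemma verma_scaleDl (u : M) : {morph verma_scale^~ u : x y / x + y}.
Proof.
by move=> x y; rewrite -[x]hreprK -[y]hreprK [_ + _]haddE !verma_scaleE.
Qed.

HB.instance Definition _ := GRing.Zmodule_isLmodule.Build H M
  verma_scaleA verma_scale1 verma_scaleDr verma_scaleDl.

Lemma Hcst_act a (u : M) : Hcst xi_prim c a *: u = verma_cst a u.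
Proof. exact: verma_scaleE. Qed.
Lemma Hgrp_act g (u : M) : Hgrp xi_prim c g *: u = verma_grp tau g u.
Proof. exact: verma_scaleE. Qed.
Lemma Hvec_act v (u : M) : Hvec xi_prim c v *: u = dunkl xi_prim c tau v u.
Proof. exact: verma_scaleE. Qed.
Lemma Hfun_act f (u : M) : Hfun xi_prim c f *: u = verma_poly (linform f) u.
Proof. exact: verma_scaleE. Qed.

Definition tensor (p : {mpoly K[2]}) (j : 'I_n) : M :=
  [ffun k => if k == j then p else 0].

Definition degree_part (d : nat) (u : M) : M := [ffun k => pihomog mdeg d (u k)].

Local Open Scope classical_set_scope.

Definition graded_submod (S : set M) : Prop :=
  submod_closed (mem S) /\ forall d u, S u -> S (degree_part d u).

Definition proper_graded_submod (S : set M) : Prop :=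
  graded_submod S /\ S <> setT.

Definition max_proper_graded_submod (S : set M) : Prop :=
  proper_graded_submod S /\
  forall T, proper_graded_submod T -> S `<=` T -> T = S.

Definition Hspan (X : set M) : set M :=
  smallest (fun S : set M => submod_closed (mem S)) X.

(* The A-submodule generated by X. *)
Definition A_submod (S : set M) : Prop :=
  [/\ S 0, forall u v, S u -> S v -> S (u + v)
    & forall p u, S u -> S (verma_poly p u)].

Definition Aspan (X : set M) : set M := smallest A_submod X.

Definition homogeneous_vec (d : nat) (u : M) : Prop := degree_part d u = u.

(* \dim_K (M(tau) / J)_d = r, for J a graded submodule: the classes of b_1, ...,
   b_r are a basis of M(tau)_d modulo J. *)
Definition quotient_dim (J : set M) (d r : nat) : Prop :=
  exists b : 'I_r -> M, (forall i, homogeneous_vec d (b i)) /\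
    forall u, homogeneous_vec d u ->
      exists! a : {ffun 'I_r -> K}, J (u - \sum_i verma_cst (a i) (b i)).

(* The coefficients of a Hilbert series, as a function of the degree. *)
Definition hilbert_series (J : set M) (h : nat -> nat) : Prop :=
  forall d, quotient_dim J d (h d).

End VermaModule.

Arguments tensor {K m xi xi_prim c c_class n tau}.
Arguments max_proper_graded_submod {K m xi xi_prim c c_class n tau}.
Arguments Hspan {K m xi xi_prim c c_class n tau}.
Arguments Aspan {K m xi xi_prim c c_class n tau}.
Arguments hilbert_series {K m xi xi_prim c c_class n tau}.

(* Main.v *)
From HB Require Import structures.
Require Import Defs.
From mathcomp Require Import all_boot all_order all_fingroup all_algebra.
From mathcomp Require Import ring.
From mathcomp Require Import mpoly boolp classical_sets.

Set Implicit Arguments.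
Unset Strict Implicit.
Unset Printing Implicit Defensive.

Import GRing.Theory.
Local Open Scope ring_scope.
Local Open Scope classical_set_scope.

(* J is the set of all p (x) e_1 + q (x) e_2 such that the coefficients of y^k in
   p and of x^k in q vanish for k < 3.  Restricting the identity
   alpha_s * ((1 - s) f / alpha_s) = f - s f to the coordinate axes expresses these
   six coefficients of D_v u through the coefficients of y^(k+1) in p and of
   x^(k+1) in q, with factors the sums S(z) = sum_l c_l z^l over the reflections
   s_l, z being a power of xi.  Conjugating by s_(l+1) gives c_(l+2) = c_l, so that
   S(z) = 0 unless z^2 = 1; for m >= 3, m <> 4, this leaves S(1) only, which is
   nonzero for generic parameters.  Hence J is stable, and a Dunkl operator brings
   any element outside J down to a nonzero component of degree 0. *)

Local Notation "p @_[ i , k ]" := (p@_(U_(i%R) *+ k%N)%MM)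
  (at level 2, i, k at level 200, format "p @_[ i ,  k ]").

Lemma mcoeff_pihomog (R : nzRingType) n d (p : {mpoly R[n]}) mon :
  (pihomog mdeg d p)@_mon = if mdeg mon == d then p@_mon else 0.
Proof.
rewrite {2}[p]mpolyE pihomogE !raddf_sum /= big_mkcond /=.
case: (eqVneq (mdeg mon) d) => [md|nd].
  apply: eq_bigr => m' _; case: eqP => // nd.
  by rewrite mcoeffZ mcoeffX; case: eqP => [E|]; rewrite ?mulr0 //; case: nd; rewrite E.
apply: big1 => m' _; case: eqP => // md.
rewrite mcoeffZ mcoeffX; case: eqP => [E|]; rewrite ?mulr0 //.
by rewrite -E md eqxx in nd.
Qed.

(** * Restriction of polynomials to the coordinate axes *)

Section Axis.
Variable K : fieldType.
Implicit Type p : {mpoly K[2]}.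

(** Restriction to the axis of ['X_i], parametrised with speed [a]. The speed is kept because a
    reflection maps one axis to the other with a factor xi^l or xi^-l. *)
Definition axis (i : 'I_2) (a : K) : {mpoly K[2]} -> {poly K} :=
  mmap polyC (fun j => if j == i then a *: 'X else 0).

Lemma mnm_axisP (i : 'I_2) (mon : 'X_{1..2}) :
  mon = (U_(i) *+ mon i)%MM \/ exists2 j, j != i & mon j != 0%N.
Proof.
case: (boolP [forall j, (j != i) ==> (mon j == 0%N)]) => [/forallP h|].
  left; apply/mnmP => j; rewrite mulmnE mnm1E.
  case: (eqVneq i j) => [->|ne]; rewrite ?mul1n // mul0n.
  by apply/eqP; have /implyP := h j; apply; rewrite eq_sym.
by rewrite negb_forall => /existsP[j]; rewrite negb_imply => /andP[]; right; exists j.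
Qed.

Lemma coef_axis i a p k : (axis i a p)`_k = a ^+ k * p@_[i, k].
Proof.
rewrite {2}[p]mpolyE /axis /mmap coef_sum raddf_sum mulr_sumr; apply: eq_bigr => mon _.
rewrite /= mcoeffZ mcoeffX mulrCA coefCM; congr (_ * _); rewrite /mmap1.
case: (mnm_axisP i mon) => [->|[j nj mj]]; last first.
  rewrite (bigD1 j) //= (negPf nj) expr0n (negPf mj) mul0r coef0.
  case: eqP => [E|]; last by rewrite mulr0.
  by move: mj; rewrite E mulmnE mnm1E [i == j]eq_sym (negPf nj).
move: (mon i) => d; rewrite (bigD1 i) //= big1 ?mulr1; last first.
  by move=> j nj; rewrite mulmnE mnm1E [i == j]eq_sym (negPf nj) mul0n expr0.
rewrite eqxx mulmnE mnm1E eqxx mul1n exprZn coefZ coefXn.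
have -> : ((U_(i) *+ d)%MM == (U_(i) *+ k)%MM) = (k == d).
  apply/eqP/eqP => [/mnmP/(_ i)|-> //]; by rewrite !mulmnE mnm1E eqxx !mul1n.
by case: eqP => [->|]; rewrite ?mulr0.
Qed.

Lemma mcoeff_axis i p k : p@_[i, k] = (axis i 1 p)`_k.
Proof. by rewrite coef_axis expr1n mul1r. Qed.

HB.instance Definition _ i a := GRing.RMorphism.on (axis i a).

Lemma axisD i a p q : axis i a (p + q) = axis i a p + axis i a q.
Proof. exact: mmapD. Qed.

Lemma axisM i a p q : axis i a (p * q) = axis i a p * axis i a q.
Proof. exact: rmorphM. Qed.

Lemma axisB i a p q : axis i a (p - q) = axis i a p - axis i a q.
Proof. exact: mmapB. Qed.

Lemma axisZ i a b p : axis i a (b *: p) = b%:P * axis i a p.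
Proof. exact: mmapZ. Qed.

Lemma axisX i a j : axis i a 'X_j = if j == i then a *: 'X else 0.
Proof. by rewrite /axis mmapX mmap1U. Qed.

Lemma axis_linform i a (f : 'rV_2) : axis i a (linform f) = (f 0 i * a) *: 'X.
Proof.
rewrite linformE raddf_sum (bigD1 i) //= big1 ?addr0.
  by rewrite axisZ axisX eqxx mul_polyC scalerA.
by move=> j nj; rewrite axisZ axisX (negPf nj) mulr0.
Qed.

Variables (m : nat) (xi : K).
Hypothesis xi_prim : m.-primitive_root xi.

(** Both sides are algebra morphisms in [p], so agreement on the variables suffices. *)
Lemma axis_eq i a j b (F : {mpoly K[2]} -> {mpoly K[2]}) :
  (forall a p q, F (a *: p + q) = a *: F p + F q) -> F 1 = 1 ->
  {morph F : p q / p * q} -> (forall k, axis i a (F 'X_k) = axis j b 'X_k) ->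
  forall p, axis i a (F p) = axis j b p.
Proof.
move=> FP F1 FM FX; elim/mpoly_alg_ind => [e p q hp hq||p q hp hq|k] //.
- by rewrite FP !axisD !axisZ hp hq.
- by rewrite F1 !rmorph1.
- by rewrite FM !axisM hp hq.
Qed.

Lemma axis1_refl (l : 'I_m) p :
  axis 1 1 (actA (reflG xi_prim l) p) = axis 0 (xi ^+ l) p.
Proof.
apply: axis_eq => [*|||k]; [exact: actAP | | exact: actA_mul |].
  by rewrite -mpolyC1 actAC.
rewrite -linform_delta actA_linform !axis_linform /= refl_inv // -rowE !mxE mulr1.
by case: k => [[|[|]]] // ?; rewrite ?mul1r ?mul0r.
Qed.

Lemma axis0_refl (l : 'I_m) p :
  axis 0 1 (actA (reflG xi_prim l) p) = axis 1 (xi ^- l) p.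
Proof.
apply: axis_eq => [*|||k]; [exact: actAP | | exact: actA_mul |].
  by rewrite -mpolyC1 actAC.
rewrite -linform_delta actA_linform !axis_linform /= refl_inv // -rowE !mxE mulr1.
by case: k => [[|[|]]] // ?; rewrite ?mul1r ?mul0r.
Qed.

Lemma actA_refl_coef1 (l : 'I_m) p k :
  (actA (reflG xi_prim l) p)@_[1, k] = (xi ^+ l) ^+ k * p@_[0, k].
Proof. by rewrite -coef_axis -axis1_refl coef_axis expr1n mul1r. Qed.

Lemma actA_refl_coef0 (l : 'I_m) p k :
  (actA (reflG xi_prim l) p)@_[0, k] = (xi ^- l) ^+ k * p@_[1, k].
Proof. by rewrite -coef_axis -axis0_refl coef_axis expr1n mul1r. Qed.

(** On the y-axis alpha_s is -xi^l y, so the restricted identity determines the restriction of the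
    quotient, one degree lower. On the x-axis alpha_s is x, whence no factor in [divdiff_coef0]. *)
Lemma divdiff_coef1 (l : 'I_m) p k :
  xi ^+ l * (divdiff xi_prim l p)@_[1, k] =
  (xi ^+ l) ^+ k.+1 * p@_[0, k.+1] - p@_[1, k.+1].
Proof.
have /(congr1 (fun q => (axis 1 1 q)`_k.+1)) := divdiffE xi_prim l p.
rewrite axisM axisB axis1_refl axis_linform coefB -scalerAl coefZ coefXM.
rewrite !mxE /= !coef_axis !expr1n !mulr1 !mul1r mulNr => E.
by rewrite -[LHS]opprK E opprB.
Qed.

Lemma divdiff_coef0 (l : 'I_m) p k :
  (divdiff xi_prim l p)@_[0, k] =
  p@_[0, k.+1] - (xi ^- l) ^+ k.+1 * p@_[1, k.+1].
Proof.
have /(congr1 (fun q => (axis 0 1 q)`_k.+1)) := divdiffE xi_prim l p.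
rewrite axisM axisB axis0_refl axis_linform coefB -scalerAl coefZ coefXM.
by rewrite !mxE /= !coef_axis !expr1n !mulr1 !mul1r => E.
Qed.

End Axis.

(** * Conjugacy of reflections and the sums S(z) *)

Section Conjugacy.
Variables (K : fieldType) (m : nat).

Lemma Gmm2_ext (g h : Gmm2 K m) : sval g = sval h -> g = h.
Proof. exact: val_inj. Qed.

Lemma Gconj_refl (s : Gmm2 K m) : Gconj s s.
Proof. by exists (Gone K m); apply: Gmm2_ext; rewrite /= mul1mx mulmx1. Qed.

Lemma Gconj_sym (s t : Gmm2 K m) : Gconj s t -> Gconj t s.
Proof.
case=> g /(congr1 sval) /= E; have [h hE] := Ginv_ex g; have gu := Gmm2_unit g.
exists h; apply: Gmm2_ext; rewrite /= hE.
by rewrite -[sval t](mulmxK gu) -E !mulmxA mulVmx // mul1mx.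
Qed.

Lemma Gconj_trans (s t u : Gmm2 K m) : Gconj s t -> Gconj t u -> Gconj s u.
Proof.
case=> g /(congr1 sval) /= E [h /(congr1 sval) /= E']; exists (Gmul h g).
by apply: Gmm2_ext; rewrite /= -mulmxA E mulmxA E' mulmxA.
Qed.

Variable xi : K.
Hypothesis xi_prim : m.-primitive_root xi.
Local Notation s_ := (reflG xi_prim).

Lemma xi_ordS (l : 'I_m) : xi ^+ (ordS l) = xi ^+ l.+1.
Proof. exact: prim_expr_mod. Qed.

(** Conjugation by s_j sends the index l to 2j - l modulo m; here j = l + 1. *)
Lemma Gconj_refl_ordS2 (l : 'I_m) : Gconj (s_ l) (s_ (ordS (ordS l))).
Proof.
exists (s_ (ordS l)); apply: Gmm2_ext; apply/matrixP => i j.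
rewrite !mxE !big_ord_recl !big_ord0 !mxE !(xi_ordS, exprS).
have x0 := xiX_unit xi_prim l; have x1 := xi_unit xi_prim.
by case: i j => [[|[|]]] //= ? [[|[|]]] //= ?;
  rewrite ?(mulr0, mul0r, addr0, add0r) //; field; rewrite ?x0.
Qed.

Variable c : Gmm2 K m -> K.

(** For z a power of xi, this is the discrete Fourier transform of the parameters c_l over Z/m. *)
Definition refl_sum (z : K) : K := \sum_(l < m) c (s_ l) * z ^+ l.

Hypothesis c_class : class_fun c.

Lemma reflG_reflection l : is_reflection (s_ l).
Proof. by apply/(is_reflectionP xi_prim); exists l. Qed.

(** Shifting l by two permutes the indices, preserves c_l and multiplies z^l by z^2, so S(z) = z^2
    S(z). *)
Lemma refl_sum_eq0 z : z ^+ m = 1 -> z ^+ 2 != 1 -> refl_sum z = 0.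
Proof.
move=> zm z2; suff E : refl_sum z = z ^+ 2 * refl_sum z.
  apply/eqP; have /eqP : (1 - z ^+ 2) * refl_sum z = 0.
    by rewrite mulrBl mul1r -E subrr.
  by rewrite mulf_eq0 subr_eq0 eq_sym (negPf z2).
have zS (l : 'I_m) : z ^+ (ordS l) = z ^+ l.+1.
  exact: (expr_mod l.+1 zm).
rewrite {1}/refl_sum mulr_sumr (reindex_inj (@ordS_inj m)) (reindex_inj (@ordS_inj m)).
apply: eq_bigr => l _; rewrite zS exprS zS exprS.
have <- : c (s_ l) = c (s_ (ordS (ordS l))).
  by apply: c_class; [exact: reflG_reflection | exact: Gconj_refl_ordS2].
by rewrite expr2; ring.
Qed.

Hypothesis c_generic : generic_params c.

(* A polynomial relation with natural coefficients that expresses refl_sum 1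
   through one reflection of each class; at (1, ..., 1) it takes the value m. *)
Lemma refl_sum1_neq0 : m%:R != 0 :> K -> refl_sum 1 != 0.
Proof.
(* [choose] depends only on the extension of an inhabited predicate, so [r] picks one index in each
   conjugacy class. *)
move=> m0; pose r (l : 'I_m) := choose (fun l' => `[< Gconj (s_ l) (s_ l') >]) l.
have rP l : Gconj (s_ l) (s_ (r l)).
  apply/asboolP; apply: (chooseP (P := fun l' => `[< Gconj (s_ l) (s_ l') >])).
  by apply/asboolP; exact: Gconj_refl.
have rE l l' : Gconj (s_ l) (s_ l') -> r l = r l'.
  move=> h; rewrite /r.
  transitivity (choose (fun l'' => `[< Gconj (s_ l) (s_ l'') >]) l').
    by apply: choose_id; apply/asboolP => //; exact: Gconj_refl.
  apply: eq_choose => k; apply/asboolP/asboolP; apply: Gconj_trans => //.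
  exact: Gconj_sym.
pose R := [set r l | l : 'I_m]%SET.
have rR l : r l \in R by apply: imset_f.
pose f (i : 'I_#|R|) := s_ (enum_val i).
pose P : {mpoly K[#|R|]} := \sum_(l < m) 'X_(enum_rank_in (rR l) (r l)).
have Pev (v : 'I_#|R| -> K) : P.@[v] = \sum_(l < m) v (enum_rank_in (rR l) (r l)).
  by rewrite raddf_sum; apply: eq_bigr => l _; exact: mevalXU.
have f_refl i : is_reflection (f i) by exact: reflG_reflection.
have f_inj i j : Gconj (f i) (f j) -> i = j.
  move=> /rE h; apply: enum_val_inj.
  case/imsetP: (enum_valP i) (enum_valP j) h => l _ -> /imsetP[l' _ ->].
  by rewrite -(rE _ _ (rP l)) -(rE _ _ (rP l')).
apply/eqP => S0; have P0 : P = 0.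
  apply: (@c_generic _ f f_refl f_inj) => [mon|].
    exists (\sum_(l < m) (U_(enum_rank_in (rR l) (r l))%MM == mon))%N.
    by rewrite raddf_sum natr_sum; apply: eq_bigr => l _; rewrite /= mcoeffX.
  rewrite Pev -[RHS]S0; apply: eq_bigr => l _.
  rewrite expr1n mulr1 /f enum_rankK_in //.
  by apply/esym; apply: c_class; [exact: reflG_reflection | exact: rP].
move: m0; have := Pev (fun=> 1); rewrite P0 meval0 sumr_const card_ord => <-.
by rewrite eqxx.
Qed.

End Conjugacy.

(** * Submodules of the Verma module over H(G) and over A *)

Section Submodules.
Variables (K : fieldType) (m : nat) (xi : K).
Hypothesis xi_prim : m.-primitive_root xi.
Variable c : Gmm2 K m -> K.
Hypothesis c_class : class_fun c.
Variables (n : nat) (tau : grep K m n).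
Local Notation M := (verma xi_prim c_class tau).
Local Notation H := (cherednik xi_prim c).
Implicit Types (S T : set M) (u v : M).

Lemma submod_closedP S :
  submod_closed (mem S) <->
  [/\ S 0, forall u v, S u -> S v -> S (u + v) & forall (h : H) u, S u -> S (h *: u)].
Proof.
split=> [[S0 SP]|[S0 SD SZ]].
  have S0' : S 0 by exact: set_mem.
  have SP' (h : H) u v : S u -> S v -> S (h *: u + v).
    by move=> Su Sv; apply: set_mem; apply: SP; exact: mem_set.
  split=> // [u v Su Sv|h u Su]; first by rewrite -[u]scale1r; exact: SP'.
  by rewrite -[_ *: u]addr0; exact: SP'.
split; first exact: mem_set.
move=> h u v /set_mem Su /set_mem Sv; apply: mem_set.
by apply: SD => //; exact: SZ.
Qed.

(** Only linear forms are generators of [H]; induction over the algebra that they generate reaches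
    every polynomial. *)
Lemma submod_verma_poly S p u : submod_closed (mem S) -> S u -> S (verma_poly p u).
Proof.
case/submod_closedP => S0 SD SZ.
elim/mpoly_alg_ind: p u => [a p q hp hq|u|p q hp hq|i u].
- move=> u Su; have -> : verma_poly (a *: p + q) u
      = (Hcst xi_prim c a *: (verma_poly p u : M) + verma_poly q u :> M).
    by rewrite Hcst_act; apply/ffunP => k; rewrite !ffunE mulrDl scalerAl.
  by apply: SD; [apply: SZ; exact: hp | exact: hq].
- by have -> : verma_poly 1 u = u by apply/ffunP => k; rewrite ffunE mul1r.
- move=> u Su; have -> : verma_poly (p * q) u = verma_poly p (verma_poly q u).
    by apply/ffunP => k; rewrite !ffunE mulrA.
  by apply: (hp (verma_poly q u)); exact: hq.
- by move=> Su; rewrite -linform_delta -Hfun_act; exact: SZ.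
Qed.

Lemma submod_verma_grp S g u : submod_closed (mem S) -> S u -> S (verma_grp tau g u).
Proof. by case/submod_closedP => _ _ SZ Su; rewrite -Hgrp_act; exact: SZ. Qed.

Lemma submod_dunkl S w u : submod_closed (mem S) -> S u -> S (dunkl xi_prim c tau w u).
Proof. by case/submod_closedP => _ _ SZ Su; rewrite -Hvec_act; exact: SZ. Qed.

Lemma submod_closed_A S : submod_closed (mem S) -> A_submod S.
Proof.
move=> hS; have [S0 SD _] := (submod_closedP S).1 hS.
by split=> // p u; exact: submod_verma_poly.
Qed.

(** Each element of [H] is the class of an expression in scalars, group elements, vectors and linear
    forms; induction on a representative reduces stability to these generators. *)
Lemma stable_submod_closed S : A_submod S ->
  (forall g u, S u -> S (verma_grp tau g u)) ->
  (forall w u, S u -> S (dunkl xi_prim c tau w u)) -> submod_closed (mem S).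
Proof.
case=> S0 SD SA SG SV; apply/submod_closedP; split=> // h.
rewrite -[h]hreprK; move: (generic_quotient.repr h) => {h}.
elim=> [a|g|v|f|e1 h1 e2 h2|e1 h1 e2 h2] u Su; rewrite [_ *: u]verma_scaleE /=.
- have -> : a *: (u : {ffun _ -> _}) = verma_poly a%:MP u.
    by apply/ffunP => k; rewrite !ffunE mul_mpolyC.
  exact: SA.
- exact: SG.
- exact: SV.
- exact: SA.
- by apply: SD; rewrite -verma_scaleE; [exact: h1 | exact: h2].
- rewrite -2!verma_scaleE; exact: (h1 _ (h2 _ Su)).
Qed.

Lemma A_submod_sum S (I : Type) (r : seq I) (F : I -> M) :
  A_submod S -> (forall i, S (F i)) -> S (\sum_(i <- r) F i).
Proof. by case=> S0 SD _ SF; elim/big_ind: _. Qed.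

End Submodules.

(** * Dunkl operators on the Verma module of rho_1 *)

Section Rho1.
Variables (K : fieldType) (m : nat) (xi : K).
Hypothesis xi_prim : m.-primitive_root xi.
Variable c : Gmm2 K m -> K.
Hypothesis c_class : class_fun c.
Local Notation tau := (rho K m (i := 1) isT).
Local Notation M := (verma xi_prim c_class tau).
Local Notation s_ := (reflG xi_prim).
Local Notation S_ := (refl_sum xi_prim c).
Implicit Types (u v : M) (w : 'cV[K]_2).

Lemma rho1_refl (l : 'I_m) i j :
  tau (s_ l) i j = if i == j then 0 else if i == 0 then xi ^- l else xi ^+ l.
Proof.
rewrite /= /rho_mx /= refl_inv // !mxE expr1.
by case: i j => [[|[|]]] //= ? [[|[|]]].
Qed.

Lemma pairing_root (l : 'I_m) w :
  pairing (root_form xi l) w = w 0 0 - xi ^+ l * w 1 0.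
Proof.
rewrite /pairing mxE big_ord_recl big_ord1 !mxE /= mul1r mulNr.
by congr (_ - _ * w _ _); apply: val_inj.
Qed.

Lemma ord2 (i : 'I_2) : i = 0 \/ i = 1.
Proof. by case: i => [[|[|]]] //= ?; [left|right]; exact: val_inj. Qed.

(** Reflections act on rho_1 by antidiagonal matrices, so each component of D_w u involves only the
    other component of u. *)
Lemma dunkl0E w u : dunkl xi_prim c tau w u 0 =
  - \sum_(l < m) (c (s_ l) * pairing (root_form xi l) w * xi ^- l)
      *: divdiff xi_prim l (u 1).
Proof.
rewrite !ffunE sum_ffunE; congr (- _); apply: eq_bigr => l _.
rewrite !ffunE big_ord_recl big_ord1 !rho1_refl /= scale0r add0r scalerA.
by congr (_ *: divdiff _ _ (u _)); apply: val_inj.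
Qed.

Lemma dunkl1E w u : dunkl xi_prim c tau w u 1 =
  - \sum_(l < m) (c (s_ l) * pairing (root_form xi l) w * xi ^+ l)
      *: divdiff xi_prim l (u 0).
Proof.
rewrite !ffunE sum_ffunE; congr (- _); apply: eq_bigr => l _.
by rewrite !ffunE big_ord_recl big_ord1 !rho1_refl /= scale0r addr0 scalerA.
Qed.

(** The arguments of S collect powers of xi^l: the pairing gives 1 or xi^l, rho_1 gives xi^-l,
    division by alpha_s gives xi^-l, and s sends x^(k+1) to xi^(l(k+1)) y^(k+1). *)
Lemma dunkl0_coef w u k : (dunkl xi_prim c tau w u 0)@_[1, k] =
  w 1 0 * (S_ (xi ^+ k) * (u 1)@_[0, k.+1] - S_ xi^-1 * (u 1)@_[1, k.+1])
  - w 0 0 * (S_ (xi ^+ k / xi) * (u 1)@_[0, k.+1] - S_ (xi ^- 2) * (u 1)@_[1, k.+1]).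
Proof.
rewrite dunkl0E mcoeffN raddf_sum /refl_sum.
rewrite !(mulr_suml, mulr_sumr, =^~ sumrB, =^~ sumrN); apply: eq_bigr => l _.
rewrite /= mcoeffZ pairing_root.
have x0 := xiX_unit xi_prim l.
(* The factor xi^l is inserted together with its inverse to match the left side of
   [divdiff_coef1]. *)
rewrite -[(divdiff _ _ _)@__](mulKf x0) divdiff_coef1 !(exprMn, exprVn).
rewrite ![(xi ^+ _) ^+ l]exprAC !exprS.
by field.
Qed.

Lemma dunkl1_coef w u k : (dunkl xi_prim c tau w u 1)@_[0, k] =
  w 1 0 * (S_ (xi ^+ 2) * (u 0)@_[0, k.+1] - S_ (xi / xi ^+ k) * (u 0)@_[1, k.+1])
  - w 0 0 * (S_ xi * (u 0)@_[0, k.+1] - S_ (xi ^- k) * (u 0)@_[1, k.+1]).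
Proof.
rewrite dunkl1E mcoeffN raddf_sum /refl_sum.
rewrite !(mulr_suml, mulr_sumr, =^~ sumrB, =^~ sumrN); apply: eq_bigr => l _.
rewrite /= mcoeffZ pairing_root divdiff_coef0 !(exprMn, exprVn).
rewrite ![(xi ^+ _) ^+ l]exprAC !exprS.
have x0 := xiX_unit xi_prim l; have x1 : (xi ^+ l) ^+ k != 0 by rewrite expf_neq0.
by field; rewrite ?x0 ?x1.
Qed.

(** The squares of the arguments are xi^2, xi^4 and their inverses; none is 1, since m divides
    neither 2 nor 4. *)
Lemma refl_sum_xi : (3 <= m)%N -> m != 4%N ->
  [/\ S_ xi = 0, S_ (xi ^+ 2) = 0, S_ xi^-1 = 0 & S_ (xi ^- 2) = 0].
Proof.
move=> m3 m4.
have xim k : (xi ^+ k) ^+ m = 1 by rewrite exprAC (prim_expr_order xi_prim) expr1n.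
have nd k : (0 < k <= 4)%N -> k != 3%N -> xi ^+ k != 1.
  move=> k4 k3; rewrite -(prim_order_dvd xi_prim).
  by case: k k4 k3 => [|[|[|[|[|]]]]] // _ _; case: (m) m3 m4 => [|[|[|[|[|]]]]].
have xi2 : xi ^+ 2 != 1 by exact: nd.
have xi4 : (xi ^+ 2) ^+ 2 != 1 by rewrite -exprM; exact: nd.
have xi1m : xi ^+ m = 1 := xim 1.
by split; (apply: refl_sum_eq0; first by [];
  rewrite ?exprVn ?xi1m ?xim ?invr1 ?invr_eq1).
Qed.

(** * The submodule J and its stability *)

Definition max_submod : set M :=
  [set u : M | forall k, (k < 3)%N -> (u 0)@_[1, k] = 0 /\ (u 1)@_[0, k] = 0].
Local Notation J := max_submod.

Lemma mcoeff_axisM (i : 'I_2) (p q : {mpoly K[2]}) k :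
  (p * q)@_[i, k] = \sum_(j < k.+1) p@_[i, j] * q@_[i, k - j].
Proof.
rewrite mcoeff_axis axisM coefM.
by apply: eq_bigr => j _; rewrite !mcoeff_axis.
Qed.

(** Restriction to an axis is multiplicative, so vanishing to order 3 along it is an ideal
    condition. *)
Lemma max_submod_A : A_submod J.
Proof.
split=> [k _|u v Ju Jv k k3|p u Ju k k3].
- by rewrite !ffunE !mcoeff0.
- have [u0 u1] := Ju k k3; have [v0 v1] := Jv k k3.
  by rewrite !ffunE !mcoeffD u0 u1 v0 v1 addr0.
- rewrite !ffunE !mcoeff_axisM; split; apply: big1 => j _;
    have [u0 u1] := Ju _ (leq_ltn_trans (leq_subr j k) k3); by rewrite ?u0 ?u1 mulr0.
Qed.

(** Reflections generate G: the diagonal element with first entry xi^l is s_l s_0. *)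
Lemma grp_refl_gen (P : Gmm2 K m -> Prop) : (forall l, P (s_ l)) ->
  (forall g h, P g -> P h -> P (Gmul g h)) -> forall g, P g.
Proof.
move=> Ps PM g; have [[l ->]//|[a am gE]] := Gmm2_cases xi_prim g.
have [l aE] := prim_rootP xi_prim am.
have m0 := prim_order_gt0 xi_prim.
suff -> : g = Gmul (s_ l) (s_ (Ordinal m0)) by exact: PM.
apply: Gmm2_ext; rewrite gE aE; apply/matrixP => i j.
rewrite /= !mxE big_ord_recl big_ord1 !mxE.
by case: i j => [[|[|]]] //= ? [[|[|]]] //= ?;
  rewrite ?expr0 ?invr1 ?(mulr0, mul0r, addr0, add0r) ?mulr1.
Qed.

Lemma grp_refl0 l u : verma_grp tau (s_ l) u 0 = xi ^- l *: actA (s_ l) (u 1).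
Proof.
rewrite !ffunE big_ord_recl big_ord1 !rho1_refl /= scale0r add0r.
by congr (_ *: actA _ (u _)); apply: val_inj.
Qed.

Lemma grp_refl1 l u : verma_grp tau (s_ l) u 1 = xi ^+ l *: actA (s_ l) (u 0).
Proof.
by rewrite !ffunE big_ord_recl big_ord1 !rho1_refl /= scale0r addr0.
Qed.

(** A reflection exchanges the two axes and, up to scalars, e_1 and e_2, so it exchanges the two
    conditions that define J. *)
Lemma max_submod_grp g u : J u -> J (verma_grp tau g u).
Proof.
elim/grp_refl_gen: g u => [l u Ju k k3|g h hg hh u Ju].
  have [u0 u1] := Ju k k3; rewrite grp_refl0 grp_refl1 !mcoeffZ.
  by rewrite actA_refl_coef0 actA_refl_coef1 u0 u1 !mulr0.
by rewrite verma_grpM; exact: (hg _ (hh _ Ju)).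
Qed.

Hypotheses (m_ge3 : (3 <= m)%N) (m_neq4 : m != 4%N).

(** Only S(xi^0) at k = 0 and S(xi / xi) at k = 1 survive. At k = 2 every sum vanishes, which the
    default 0 of the two-entry list expresses. *)
Lemma dunkl0_lt3 w u k : (k < 3)%N -> (dunkl xi_prim c tau w u 0)@_[1, k] =
  [:: w 1 0; - w 0 0]`_k * S_ 1 * (u 1)@_[0, k.+1].
Proof.
have [S1 S2 S3 S4] := refl_sum_xi m_ge3 m_neq4; have x0 := xi_unit xi_prim.
case: k => [|[|[|]]] // _; rewrite dunkl0_coef /=.
- by rewrite expr0 mul1r S3 S4; ring.
- by rewrite expr1 mulfV // S1 S3 S4; ring.
- by rewrite expr2 mulfK // -expr2 S1 S2 S3 S4; ring.
Qed.

Lemma dunkl1_lt3 w u k : (k < 3)%N -> (dunkl xi_prim c tau w u 1)@_[0, k] =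
  [:: w 0 0; - w 1 0]`_k * S_ 1 * (u 0)@_[1, k.+1].
Proof.
have [S1 S2 S3 S4] := refl_sum_xi m_ge3 m_neq4; have x0 := xi_unit xi_prim.
case: k => [|[|[|]]] // _; rewrite dunkl1_coef /=.
- by rewrite expr0 invr1 mulr1 S1 S2; ring.
- by rewrite expr1 mulfV // S1 S2 S3; ring.
- have -> : xi / xi ^+ 2 = xi^-1 by field.
  by rewrite S1 S2 S3 S4; ring.
Qed.

Lemma max_submod_dunkl w u : J u -> J (dunkl xi_prim c tau w u).
Proof.
move=> Ju k k3; rewrite dunkl0_lt3 // dunkl1_lt3 //.
(* At k = 2 a coefficient of degree 3 appears, which J does not control; the default 0 of the list
   removes it. *)
case: k k3 => [|[|[|]]] // _; last by rewrite /= !mul0r.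
- by have [-> ->] := Ju 1 isT; rewrite !mulr0.
- by have [-> ->] := Ju 2 isT; rewrite !mulr0.
Qed.

Lemma mdeg_axis (i : 'I_2) k : mdeg (U_(i) *+ k)%MM = k.
Proof. by rewrite mdegMn mdeg1 mul1n. Qed.

Lemma degree_part_coef d u (i j : 'I_2) k :
  (degree_part d u i)@_[j, k] = if k == d then (u i)@_[j, k] else 0.
Proof. by rewrite ffunE mcoeff_pihomog mdeg_axis. Qed.

Lemma max_submod_graded : graded_submod J.
Proof.
split.
  by apply: stable_submod_closed;
    [exact: max_submod_A | exact: max_submod_grp | exact: max_submod_dunkl].
by move=> d u Ju k k3; rewrite !degree_part_coef; case: eqP => // _; exact: Ju.
Qed.

Lemma max_submod_proper : proper_graded_submod J.
Proof.
split; first exact: max_submod_graded.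
move=> JT; have /(_ 0%N isT)[+ _] : J (tensor 1 0) by rewrite JT.
by rewrite ffunE /= mulm0n mcoeff1 eqxx => /eqP; rewrite oner_eq0.
Qed.

(** * Maximality and uniqueness of J *)

Lemma tensor_sum u : u = tensor (u 0) 0 + tensor (u 1) 1 :> M.
Proof.
by apply/ffunP => k; rewrite !ffunE; case: (ord2 k) => -> /=;
  rewrite ?addr0 ?add0r.
Qed.

Lemma verma_poly_tensor p q i : verma_poly p (tensor q i : M) = tensor (p * q) i :> M.
Proof. by apply/ffunP => k; rewrite !ffunE; case: eqP; rewrite ?mulr0. Qed.

Lemma grp_tensor0 l a :
  verma_grp tau (s_ l) (tensor a%:MP 0 : M) = tensor (xi ^+ l * a)%:MP 1 :> M.
Proof.
apply/ffunP => k; rewrite [RHS]ffunE; case: (ord2 k) => ->.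
  by rewrite grp_refl0 ffunE /= -mpolyC0 actAC mpolyC0 scaler0.
by rewrite grp_refl1 ffunE /= actAC mpolyCM mul_mpolyC.
Qed.

Lemma grp_tensor1 l a :
  verma_grp tau (s_ l) (tensor a%:MP 1 : M) = tensor (xi ^- l * a)%:MP 0 :> M.
Proof.
apply/ffunP => k; rewrite [RHS]ffunE; case: (ord2 k) => ->.
  by rewrite grp_refl0 ffunE /= actAC mpolyCM mul_mpolyC.
by rewrite grp_refl1 ffunE /= -mpolyC0 actAC mpolyC0 scaler0.
Qed.

(** A reflection maps e_1 and e_2 to nonzero multiples of each other, so both lie in T, and they
    generate the module over A. *)
Lemma submod_tensor_full (T : set M) i a : submod_closed (mem T) ->
  a != 0 -> T (tensor a%:MP i) -> T = setT.
Proof.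
move=> hT a0 Ta; have [_ TD TA] := submod_closed_A hT.
have T1 : T (tensor 1 i).
  have -> : tensor 1 i = verma_poly (a^-1)%:MP (tensor a%:MP i : M) :> M.
    by rewrite verma_poly_tensor -mpolyCM mulVf.
  exact: TA.
have {T1 Ta} [T0 T1] : T (tensor 1 0) /\ T (tensor 1 1).
  have m0 := prim_order_gt0 xi_prim.
  have /= Ts := submod_verma_grp (s_ (Ordinal m0)) hT T1.
  by case: (ord2 i) T1 Ts => -> T1; rewrite -mpolyC1 ?grp_tensor0 ?grp_tensor1;
    rewrite expr0 ?invr1 mulr1 mpolyC1.
apply/seteqP; split=> // u _; rewrite [u]tensor_sum; apply: TD.
  by rewrite -[u 0]mulr1 -verma_poly_tensor; exact: TA.
by rewrite -[u 1]mulr1 -verma_poly_tensor; exact: TA.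
Qed.

(* rho_1 is irreducible: two reflections separate the coordinates, as xi^2 <> 1. *)
Lemma submod_const_full (T : set M) a b : submod_closed (mem T) ->
  (a != 0) || (b != 0) -> T (tensor a%:MP 0 + tensor b%:MP 1) -> T = setT.
Proof.
move=> hT ab Tu; have [_ TD TA] := submod_closed_A hT.
set u := _ + _ in Tu; have m0 := prim_order_gt0 xi_prim.
have m1 : (1 < m)%N by apply: leq_trans m_ge3.
have x0 := xi_unit xi_prim.
(* The choice z = -xi^-1 removes the e_1 component and z = -xi the e_2 component; the other one
   keeps a factor xi - xi^-1 up to sign, which is nonzero as m > 2. *)
pose r z : M := verma_grp tau (s_ (Ordinal m1)) u
  + verma_poly z%:MP (verma_grp tau (s_ (Ordinal m0)) u).
have Tr z : T (r z).
  by apply: TD; [|apply: TA]; exact: submod_verma_grp.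
have rE z : r z = tensor ((xi^-1 + z) * b)%:MP 0 + tensor ((xi + z) * a)%:MP 1.
  have u0 : u 0 = a%:MP by rewrite !ffunE /= addr0.
  have u1 : u 1 = b%:MP by rewrite !ffunE /= add0r.
  apply/ffunP => k; rewrite ffunE [in RHS]ffunE [verma_poly _ _ k]ffunE.
  case: (ord2 k) => ->; rewrite ?grp_refl0 ?grp_refl1 ?u0 ?u1 actAC actAC.
    by rewrite !ffunE /= -!mul_mpolyC -!mpolyCM -mpolyCD addr0 invr1; congr _%:MP; ring.
  by rewrite !ffunE /= -!mul_mpolyC -!mpolyCM -mpolyCD add0r; congr _%:MP; ring.
have xiV : xi - xi^-1 != 0.
  rewrite subr_eq0; apply/eqP => E; have : (m %| 2)%N.
    by rewrite (prim_order_dvd xi_prim) expr2 {1}E mulVf.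
  by move/dvdn_leq => /(_ isT); rewrite leqNgt m_ge3.
case/orP: ab => [a0|b0].
  apply: (@submod_tensor_full T 1 ((xi - xi^-1) * a)) => //; first by rewrite mulf_neq0.
  have := Tr (- xi^-1); rewrite rE subrr mul0r mpolyC0.
  by congr T; apply/ffunP => k; rewrite !ffunE if_same add0r.
apply: (@submod_tensor_full T 0 ((xi^-1 - xi) * b)) => //.
  by rewrite mulf_neq0 // -opprB oppr_eq0.
have := Tr (- xi); rewrite rE subrr mul0r mpolyC0.
by congr T; apply/ffunP => k; rewrite !ffunE if_same addr0.
Qed.

Hypothesis refl_sum1 : S_ 1 != 0.

Lemma degree_part0 u :
  degree_part 0 u = tensor ((u 0)@_[1, 0])%:MP 0 + tensor ((u 1)@_[0, 0])%:MP 1.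
Proof.
have E (p : {mpoly K[2]}) i : pihomog mdeg 0 p = (p@_[i, 0])%:MP.
  apply/mpolyP => mon; rewrite mcoeff_pihomog mcoeffC mulm0n mdeg_eq0 eq_sym.
  by case: eqP => [->|]; rewrite ?mulr1 ?mulr0.
apply/ffunP => k; rewrite [RHS]ffunE !ffunE.
by case: (ord2 k) => -> /=; rewrite ?addr0 ?add0r -E.
Qed.

(* The Dunkl operator along (1, 1) takes the coefficients of y^k (x) e_1 and
   x^k (x) e_2 for k < 3 one step down, so some power of it sends u to an element
   with a nonzero component in degree 0. *)
Lemma graded_submod_full (T : set M) u k : graded_submod T -> T u -> (k < 3)%N ->
  ((u 0)@_[1, k] != 0) || ((u 1)@_[0, k] != 0) -> T = setT.
Proof.
case=> hT gT; elim: k u => [|k IH] u Tu k3 uk.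
  by apply: (submod_const_full hT uk); rewrite -degree_part0; exact: gT.
(* Both entries of (1, 1) are nonzero, so for either component the list entry is 1 at k = 0 and -1
   at k = 1. *)
apply: (IH (dunkl xi_prim c tau (const_mx 1) u)); [exact: submod_dunkl | exact: ltnW |].
rewrite dunkl0_lt3 ?dunkl1_lt3 ?(ltnW k3) //.
rewrite !mxE !mulf_eq0 !(negPf refl_sum1) orbC.
by case: k k3 uk {IH} => [|[|]] //= _; rewrite ?oppr_eq0 oner_eq0.
Qed.

(** This is stronger than maximality: J is the largest proper graded submodule, which also gives
    uniqueness. *)
Lemma proper_sub_max (T : set M) :
  proper_graded_submod T -> T `<=` J.
Proof.
case=> hT TT u Tu k k3; case: (boolP (((u 0)@_[1, k] != 0) || ((u 1)@_[0, k] != 0))).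
  by move/(graded_submod_full hT Tu k3).
by rewrite negb_or !negbK => /andP[/eqP-> /eqP->].
Qed.

Lemma max_submod_max : max_proper_graded_submod J.
Proof.
split; first exact: max_submod_proper.
by move=> T pT JT; apply/seteqP; split=> //; exact: proper_sub_max.
Qed.

Lemma max_submod_uniq (T : set M) : max_proper_graded_submod T -> T = J.
Proof.
case=> pT Tmax; apply/esym; apply: Tmax; first exact: max_submod_proper.
exact: proper_sub_max.
Qed.

(** * Generators of J *)

Definition gens : set M :=
  [set tensor 'X_0 0; tensor 'X_1 1; tensor ('X_0 ^+ 3) 1; tensor ('X_1 ^+ 3) 0].

Lemma mcoeffXn_axis i j d k :
  ('X_i ^+ d : {mpoly K[2]})@_[j, k] =
  (if i == j then k == d else (d == 0%N) && (k == 0%N))%:R.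
Proof.
rewrite mcoeff_axis rmorphXn /= axisX.
case: eqP => _; first by rewrite scale1r coefXn.
by rewrite expr0n; case: d => [|d]; rewrite ?coef0 // coef1.
Qed.

Lemma gens_sub_max : gens `<=` J.
Proof.
have X1 i j k : ('X_i : {mpoly K[2]})@_[j, k] = ((i == j) && (k == 1%N))%:R.
  by rewrite -['X_i]expr1 mcoeffXn_axis; case: eqP.
by move=> u [[[]|]|] -> k k3; rewrite !ffunE /= ?mcoeff0 ?X1 ?mcoeffXn_axis //=;
  rewrite (ltn_eqF k3).
Qed.

Lemma max_sub_Aspan : J `<=` Aspan gens.
Proof.
move=> u Ju T [TA Tg]; have [_ TD TP] := TA.
(* [1 - i] is the other index. If p vanishes to order d along the axis of ['X_(1 - i)], each of its
   monomials is divisible by ['X_i] or by ['X_(1 - i) ^+ d]. *)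
have tX (p : {mpoly K[2]}) (i j : 'I_2) d :
  T (tensor 'X_i j) -> T (tensor ('X_(1 - i) ^+ d) j) ->
  (forall k, (k < d)%N -> p@_[1 - i, k] = 0) -> T (tensor p j).
  move=> Ti Tc pk.
  have -> : tensor p j = \sum_(mon <- msupp p)
      verma_poly (p@_mon *: 'X_[mon]) (tensor 1 j : M) :> M.
    apply/ffunP => k; rewrite sum_ffunE ffunE; case: eqP => kj.
      rewrite {1}[p]mpolyE; apply: eq_bigr => mon _.
      by rewrite !ffunE kj eqxx mulr1.
    by rewrite big1 // => mon _; rewrite !ffunE; case: eqP => // _; rewrite mulr0.
  apply: A_submod_sum => // mon; rewrite verma_poly_tensor mulr1.
  have T0 : T (tensor 0 j).
    by rewrite -(mul0r ('X_i)) -verma_poly_tensor; exact: TP.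
  case: (mnm_axisP (1 - i) mon) => [->|[k nk k0]].
    move: (mon (1 - i)) => e; case: (ltnP e d) => [/pk->|de]; first by rewrite scale0r.
    by rewrite -mpolyXn -(subnK de) exprD scalerAl -verma_poly_tensor; exact: TP.
  have ki : k = i by move: nk; case: (ord2 k) => ->; case: (ord2 i) => ->.
  have iU : (U_(i) <= mon)%MM by rewrite lep1mP -ki.
  by rewrite -(submK iU) mpolyXD scalerAl -verma_poly_tensor; exact: TP.
rewrite [u]tensor_sum; apply: TD.
  apply: (tX _ 0 0 3%N) => [||k k3]; [by apply: Tg; do 3 left| by apply: Tg; right |].
  by have [] := Ju k k3.
apply: (tX _ 1 1 3%N) => [||k k3]; [by apply: Tg; do 2 left; right| |].
  by rewrite subrr; apply: Tg; left; right.
by rewrite subrr; have [] := Ju k k3.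
Qed.

Lemma max_submod_Aspan : J = Aspan gens.
Proof.
apply/seteqP; split; first exact: max_sub_Aspan.
by apply: smallest_sub; [exact: max_submod_A | exact: gens_sub_max].
Qed.

(** Every submodule over [H] is one over A, so the [H]-span contains the A-span, which is already J;
    conversely J is an [H]-submodule that contains the generators. *)
Lemma max_submod_Hspan : J = Hspan gens.
Proof.
apply/seteqP; split=> [u Ju T [hT gT]|].
  by apply: (max_sub_Aspan Ju); split=> //; exact: submod_closed_A.
by apply: smallest_sub; [by case: max_submod_max => -[[]] | exact: gens_sub_max].
Qed.

(** * Hilbert series of the quotient *)

Lemma homogeneous_coef d u (i j : 'I_2) k : homogeneous_vec d u -> k != d ->
  (u i)@_[j, k] = 0.
Proof. by move=> <- /negPf kd; rewrite degree_part_coef kd. Qed.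

Lemma quotient_dim_lt3 d : (d < 3)%N -> quotient_dim J d 2.
Proof.
(* The basis modulo J is y^d (x) e_1, x^d (x) e_2; coordinates in it are the two coefficients whose
   vanishing defines J in degree d. *)
move=> d3; pose b (i : 'I_2) : M := tensor ('X_(1 - i) ^+ d) i.
have bE (a : {ffun 'I_2 -> K}) k :
    (\sum_i verma_cst (a i) (b i)) k = a k *: 'X_(1 - k) ^+ d.
  rewrite sum_ffunE (bigD1 k) //= big1 ?addr0.
    by rewrite !ffunE eqxx.
  by move=> j nj; rewrite !ffunE eq_sym (negPf nj) scaler0.
exists b; split=> [i|u hu].
  apply/ffunP => k; rewrite !ffunE; case: eqP => _; last by rewrite raddf0.
  by rewrite mpolyXn pihomogX /= mdeg_axis eqxx.
exists [ffun i => (u i)@_[1 - i, d]]; split.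
  move=> k k3; rewrite !ffunE !bE !mcoeffB !mcoeffZ !mcoeffXn_axis !ffunE.
  rewrite subr0 subrr !eqxx.
  case: eqP => [->|/eqP kd]; first by rewrite !mulr1 !subrr.
  by rewrite !(homogeneous_coef _ _ hu kd) !mulr0 subrr.
move=> a Ja; apply/ffunP => i; rewrite ffunE.
have [] := Ja d d3; rewrite !ffunE !bE !mcoeffB !mcoeffZ !mcoeffXn_axis.
rewrite subr0 subrr !eqxx !mulr1.
move=> /eqP + /eqP; rewrite !subr_eq0.
by case: (ord2 i) => -> /eqP ? /eqP ?; rewrite ?subrr ?subr0.
Qed.

(** The conditions that define J concern degrees below 3 only, so J contains every homogeneous
    element of degree d. *)
Lemma quotient_dim_ge3 d : (3 <= d)%N -> quotient_dim J d 0.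
Proof.
move=> d3; exists (fun=> 0); split=> [[]|u hu] //.
exists [ffun=> 0]; split=> [k k3|a _]; last by apply/ffunP => [[]].
rewrite big_ord0 subr0 !(homogeneous_coef _ _ hu) //.
  by rewrite ltn_eqF // (leq_trans k3).
by rewrite ltn_eqF // (leq_trans k3).
Qed.

Lemma max_submod_hilbert :
  hilbert_series J (fun d => (2 + 2 *: 'X + 2 *: 'X^2 : {poly nat})`_d).
Proof.
move=> d; rewrite -[2 : {poly nat}]/(1 + 1) !coefD !coefZ coefX coefXn coef1.
by case: d => [|[|[|d]]]; [exact: quotient_dim_lt3..|exact: quotient_dim_ge3].
Qed.

End Rho1.

Unset Implicit Arguments.

(* m = 4 has to be excluded: there D_v (x (x) e_1) = 2 (d - c) (1 (x) e_2) for v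
   the second basis vector of h, so that x (x) e_1 does not lie in J. *)
Theorem proposition7p2 (K : fieldType) (p m : nat) (xi : K)
    (charK : p \in [pchar K]) (p_neq2 : p != 2%N) (p_ndvd_m : ~~ (p %| m)%N)
    (m_ge3 : (3 <= m)%N) (m_neq4 : m != 4%N)
    (xi_prim : m.-primitive_root xi)
    (c : Gmm2 K m -> K) (c_class : class_fun c) (c_generic : generic_params c) :
  let rho1 := rho K m (i := 1) isT in
  let x : {mpoly K[2]} := 'X_0 in
  let y : {mpoly K[2]} := 'X_1 in
  let e1 : 'I_2 := 0 in
  let e2 : 'I_2 := 1 in
  let gens : set (verma xi_prim c_class rho1) :=
    [set tensor x e1; tensor y e2; tensor (x ^+ 3) e2; tensor (y ^+ 3) e1] in
  exists J : set (verma xi_prim c_class rho1),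
    [/\ max_proper_graded_submod J,
        forall J' : set (verma xi_prim c_class rho1), max_proper_graded_submod J' -> J' = J,
        J = Hspan gens,
        J = Aspan gens
      & hilbert_series J (fun d => (2 + 2 *: 'X + 2 *: 'X^2 : {poly nat})`_d)].
Proof.
have m0 : m%:R != 0 :> K by rewrite -(dvdn_pcharf charK).
have S1 := refl_sum1_neq0 xi_prim c_class c_generic m0.
move=> rho1 x y e1 e2 gens.
exists (@max_submod K m xi xi_prim c c_class); split.
- exact: max_submod_max.
- by move=> J'; exact: max_submod_uniq.
- exact: max_submod_Hspan.
- exact: max_submod_Aspan.
- exact: max_submod_hilbert.
Qed.
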